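(* Let $p\leq q$ be positive integers and $L,M,N\in\mathrm{Gr}_{p,q}$. Let $\varphi_j=\Psi_j[L,M]$, $\psi_j=\Psi_j[M,N]$, $\theta_j=\Psi_j[L,N]$ for $j=1,\dots,p$. Let $\mathcal{Z}\subset\mathbb{R}^p$ be the convex hull of the $W_p$-orbit of the vector $(\psi_1,\dots,\psi_p)$, and let $\mathcal{U}=(\varphi_1,\dots,\varphi_p)+\mathcal{Z}$. Then there exists a vector $(\theta_1^\circ,\dots,\theta_p^\circ)\in\mathcal{U}$ such that the collection of numbers $(\cos\theta_1^\circ,\dots,\cos\theta_p^\circ)$ coincides, up to a permutation, with the collection $(\cos\theta_1,\dots,\cos\theta_p)$.
   Context: $\mathrm{Gr}_{p,q}$ is the set of $p$-dimensional linear subspaces of $\mathbb{R}^{p+q}$ with the standard scalar product $\langle\cdot,\cdot\rangle$. For $L,M\in\mathrm{Gr}_{p,q}$ choose orthonormal bases $e_1,\dots,e_p$ of $L$ and $f_1,\dots,f_p$ of $M$ and let $\Lambda$ be the $p\times p$ matrix with entries $\langle e_i,f_j\rangle$; its singular values $\lambda_1\geq\dots\geq\lambda_p$ do not depend on the bases. The Jordan angles are $\Psi_j[L,M]:=\arccos\lambda_j$, so $0\leq\Psi_1[L,M]\leq\dots\leq\Psi_p[L,M]\leq\pi/2$. $W_p$ is the group of linear transformations of $\mathbb{R}^p$ generated by permutations of coordinates and sign changes $(t_1,\dots,t_p)\mapsto(\sigma_1t_1,\dots,\sigma_pt_p)$, $\sigma_j=\pm1$. *)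

(* Defs.v *)
From HB Require Import structures.
From mathcomp Require Import all_boot all_order all_algebra all_fingroup.
From mathcomp Require Import all_classical all_reals all_analysis.
Set Implicit Arguments. Unset Strict Implicit. Unset Printing Implicit Defensive.
Import Order.TTheory GRing.Theory Num.Theory.
Local Open Scope ring_scope.

Section Defs.
Variable R : realType.

(* A point of Gr_{p,q} is represented by an orthonormal basis e_1..e_p of it,
   stored as the rows of a p x (p+q) matrix. *)
Definition orthonormal_rows (p n : nat) (A : 'M[R]_(p, n)) : Prop :=
  A *m A^T = 1%:M.

Definition Lambda (p n : nat) (A B : 'M[R]_(p, n)) : 'M[R]_p := A *m B^T.

Definition singular_values (p : nat) (Lam : 'M[R]_p) (s : 'rV[R]_p) : Prop :=
  (forall i, 0 <= s 0 i) /\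
  (forall i j : 'I_p, (i <= j)%N -> s 0 j <= s 0 i) /\
  char_poly (Lam^T *m Lam) = \prod_(i < p) ('X - (s 0 i ^+ 2)%:P).

Definition jordan_angles (p : nat) (s : 'rV[R]_p) : 'rV[R]_p :=
  \row_j acos (s 0 j).

Definition W_act (p : nat) (sigma : 'S_p) (eps : 'I_p -> bool) (v : 'rV[R]_p)
  : 'rV[R]_p := \row_j ((-1) ^+ eps j * v 0 (sigma j)).

Definition W_orbit (p : nat) (v : 'rV[R]_p) : 'rV[R]_p -> Prop :=
  fun u => exists (sigma : 'S_p) (eps : 'I_p -> bool), u = W_act sigma eps v.

Definition convex_hull (p : nat) (S : 'rV[R]_p -> Prop) : 'rV[R]_p -> Prop :=
  fun x => exists (n : nat) (v : 'I_n -> 'rV[R]_p) (c : 'I_n -> R),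
    (forall k, S (v k)) /\ (forall k, 0 <= c k) /\
    \sum_(k < n) c k = 1 /\ x = \sum_(k < n) c k *: v k.

End Defs.

(* Main.v *)
(* Writing [R_L] for the reflection fixing [L], the unitary matrix [R_L R_M] has eigenphases
   [2 phi_j], [- 2 phi_j] and [0], and [R_L R_N = (R_L R_M) (R_M R_N)].  A Lidskii inequality for
   phases of products of unitary matrices then bounds, for [0 <= c <= pi / 2],
   [sum_j (|theta_j - phi_j| - c)_+] by [sum_j (psi_j - c)_+].  This is weak majorization of
   [theta - phi] by [psi], hence [theta - phi] lies in the convex hull of the orbit of [psi], and
   [theta] itself is the required vector.

   The Lidskii inequality is reduced to rank-one unitary perturbations, whose phases move in one
   direction only, by a total amount determined by the determinant.  Working with phases lifted
   to the line makes continuity arguments in the matrix unnecessary. *)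
Require Import Defs.
From HB Require Import structures.
From mathcomp Require Import all_boot all_order all_algebra all_fingroup.
From mathcomp Require Import all_classical all_reals all_analysis.
From mathcomp Require Import spectral complex ring lra zify.
Import Order.TTheory GRing.Theory Num.Theory numFieldNormedType.Exports.
Local Open Scope ring_scope.
Set Implicit Arguments. Unset Strict Implicit. Unset Printing Implicit Defensive.

(** * Points of the unit circle *)

Section Phases.
Variable R : realType.
Implicit Types s t : R.

(** Eigenvalues fix phases only up to order and multiples of [2 pi], so an inequality between the
    phases of [U], [V] and [U V] has no meaning until lifts are chosen. Each perturbation result
    therefore produces some lift together with two facts: no phase has decreased, and the sum has
    grown by exactly the prescribed amount. Reaching one matrix along two routes gives two lifts of
    one spectrum with equal sums; they differ by a permutation and by integer turns of total zero,
    and an exchange argument shows that the ordered pairing without turns gives the smallest sum.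
    Reflections fit this scheme: doubled angles of both signs stay in [[- pi, pi]], so all
    differences are at most one turn, and they sum to 0, so the sums match exactly and not only
    modulo [2 pi]. The mirrored phases also turn positive parts of differences into those of
    absolute values, as an orbit under sign changes demands. *)

Definition expi t : R[i] := Complex (cos t) (sin t).

Lemma expiD s t : expi (s + t) = expi s * expi t.
Proof. by rewrite /expi cosD sinD; congr Complex; rewrite addrC. Qed.

Lemma expi0 : expi 0 = 1.
Proof. by rewrite /expi cos0 sin0. Qed.

Lemma expi2pi : expi (pi *+ 2) = 1.
Proof. by rewrite /expi cos2pi sin2pi. Qed.

Lemma expiN t : expi (- t) * expi t = 1.
Proof. by rewrite -expiD addNr expi0. Qed.

Lemma expi_conj t : (expi t)^* = expi (- t).
Proof. by rewrite /expi cosN sinN. Qed.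

Lemma expi_nat_period t n : expi (t + pi *+ 2 *+ n) = expi t.
Proof.
elim: n => [|n IH]; first by rewrite mulr0n addr0.
by rewrite mulrSr addrA expiD IH expi2pi mulr1.
Qed.

Lemma expi_int_period t (m : int) : expi (t + pi *+ 2 *~ m) = expi t.
Proof.
case: m => n; first exact: expi_nat_period.
by rewrite -[LHS](expi_nat_period _ n.+1) NegzE mulrNz -pmulrn subrK.
Qed.

Lemma phase_reduce t : exists m : int, 0 <= t + pi *+ 2 *~ m < pi *+ 2.
Proof.
have p0 : 0 < (pi : R) *+ 2 by rewrite mulrn_wgt0 ?pi_gt0.
exists (- Num.floor (t / (pi *+ 2))).
have /andP[h1 h2] := floor_itv (t / (pi *+ 2)).
move: h1 h2; rewrite intrD ler_pdivlMr // ltr_pdivrMr // mulrDl mul1r.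
by rewrite mulrNz -[pi *+ 2 *~ _]mulrzl subr_ge0 ltrBlDl addrC => -> ->.
Qed.

Lemma expi_eq1 t : 0 <= t < pi *+ 2 -> expi t = 1 -> t = 0.
Proof.
move=> /andP[t0 t2] [ct st]; apply/eqP; rewrite eq_le t0 andbT leNgt.
apply/negP => tpos; case: (ltgtP t pi) => tpi.
- by move: (@sin_gt0_pi _ t); rewrite tpos tpi st ltxx => /(_ isT).
- move: (@sin_gt0_pi _ (t - pi)); rewrite subr_gt0 tpi /= ltrBlDr -mulr2n t2.
  by move=> /(_ isT); rewrite -(opprK (sin _)) -sinDpi subrK st oppr0 ltxx.
- by move: ct; rewrite tpi cospi => /eqP; rewrite lt_eqF // (lt_trans _ ltr01) // ltrN10.
Qed.

Lemma expi_eq s t : expi s = expi t -> exists m : int, s = t + pi *+ 2 *~ m.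
Proof.
move=> est; have [m hm] := phase_reduce (s - t); exists (- m).
have /(expi_eq1 hm) : expi (s - t + pi *+ 2 *~ m) = 1.
  by rewrite expi_int_period expiD est mulrC expiN.
by rewrite mulrNz => h; apply/eqP; rewrite -subr_eq0 -h; apply/eqP; ring.
Qed.

(** A chord of the unit circle is perpendicular to its mean direction. Factoring that direction out
    is what makes the secular equation real. *)
Lemma expi_sub s t :
  expi t - expi s = expi ((t + s) / 2) * Complex 0 (sin ((t - s) / 2) *+ 2).
Proof.
set u := (t + s) / 2; set v := (t - s) / 2.
have -> : t = u + v by rewrite /u /v; field.
have -> : s = u - v by rewrite /u /v; field.
rewrite !expiD /expi cosN sinN.
by apply/eqP; rewrite eq_complex /=; apply/andP; split; apply/eqP; ring.
Qed.

End Phases.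

(** * The secular equation of a rank-one unitary perturbation *)

Section Secular.
Local Open Scope complex_scope.
Variable R : realType.

(* For [U = diag e] unitary and a unit row vector [v], this is the characteristic polynomial of
   [U (1 + k v^* v)], where [w j = |v j|^2]. *)
Definition secular n (e : 'I_n -> R[i]) (w : 'I_n -> R) (k : R[i]) : {poly R[i]} :=
  \prod_j ('X - (e j)%:P)
  - k *: \sum_j ((w j)%:C * e j) *: \prod_(i | i != j) ('X - (e i)%:P).

(** For weights of sum 1, this is what remains of [secular] at [expi t], with parameter
    [expi (b *+ 2) - 1], after nonvanishing factors are removed: a real function, open to the
    intermediate value theorem. *)
Definition secular_trig n (a : 'I_n -> R) (w : 'I_n -> R) (b t : R) : R :=
  cos b * \prod_i sin ((t - a i) / 2)
  - sin b * \sum_j w j * cos ((t - a j) / 2) * \prod_(i | i != j) sin ((t - a i) / 2).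

Lemma size_index_enum_ord n : size (index_enum 'I_n) = n.
Proof. by rewrite [index_enum _]unlock -enumT size_enum_ord. Qed.

Lemma size_prod_XsubC_neq n (e : 'I_n -> R[i]) (j : 'I_n) :
  size (\prod_(i | i != j) ('X - (e i)%:P)) = n.
Proof.
have := size_prod_XsubC (index_enum 'I_n) e.
rewrite (bigD1 j) //= size_monicM ?monicXsubC //; last first.
  by rewrite monic_neq0 // monic_prod // => i _; apply: monicXsubC.
rewrite size_XsubC add2n /= => -[->].
by rewrite size_index_enum_ord.
Qed.

Lemma size_secular n (e : 'I_n -> R[i]) w k : size (secular e w k) = n.+1.
Proof.
rewrite size_polyDl size_prod_XsubC ?size_index_enum_ord //.
rewrite size_polyN ltnS (leq_trans (size_scale_leq _ _)) //.
rewrite (leq_trans (size_sum _ _ _)) //; apply/bigmax_leqP => j _.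
by rewrite (leq_trans (size_scale_leq _ _)) // size_prod_XsubC_neq.
Qed.

Lemma secular_monic n (e : 'I_n -> R[i]) w k : secular e w k \is monic.
Proof.
rewrite monicE lead_coefDl ?lead_coef_prod_XsubC //.
rewrite size_polyN size_prod_XsubC size_index_enum_ord.
rewrite ltnS (leq_trans (size_scale_leq _ _)) //.
rewrite (leq_trans (size_sum _ _ _)) //; apply/bigmax_leqP => j _.
by rewrite (leq_trans (size_scale_leq _ _)) // size_prod_XsubC_neq.
Qed.

Lemma horner_secular0 n (e : 'I_n -> R[i]) w k : \sum_j w j = 1 ->
  (secular e w k).[0] = (1 + k) * \prod_j (- e j).
Proof.
move=> w1; rewrite /secular !hornerE horner_prod horner_sum.
under eq_bigr do rewrite !hornerE.
have -> : \sum_j ((w j)%:C * e j *: \prod_(i | i != j) ('X - (e i)%:P)).[0]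
   = - \sum_j (w j)%:C * \prod_j (- e j).
  rewrite -sumrN; apply: eq_bigr => j _; rewrite !hornerE horner_prod.
  rewrite [in RHS](bigD1 j) //=; under eq_bigr do rewrite !hornerE.
  by ring.
rewrite -mulr_suml -rmorph_sum w1 /=.
by ring.
Qed.

Lemma horner_secular n (a w : 'I_n -> R) (b t : R) : \sum_j w j = 1 ->
  (secular (fun j => expi (a j)) w (expi (b *+ 2) - 1)).[expi t] =
  \prod_j (expi ((t + a j) / 2) * Complex 0 2) * expi b * (secular_trig a w b t)%:C.
Proof.
move=> w1; rewrite /secular !hornerE horner_prod horner_sum.
set E := fun j => expi ((t + a j) / 2) * Complex 0 2.
pose s j : R := sin ((t - a j) / 2).
have Es j : expi t - expi (a j) = E j * (s j)%:C.
  rewrite expi_sub /E -mulrA; congr (_ * _); rewrite /s.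
  by apply/eqP; rewrite eq_complex /=; apply/andP; split; apply/eqP; ring.
under eq_bigr do rewrite !hornerE Es.
rewrite big_split /=.
have eE j : expi (a j) * Complex 0 2 = E j * expi (- ((t - a j) / 2)).
  by rewrite /E mulrAC -expiD; congr (expi _ * _); field.
have -> : expi (b *+ 2) - 1 = Complex 0 2 * (expi b * (sin b)%:C).
  rewrite -expi0 expi_sub.
  have -> : (b *+ 2 + 0) / 2 = b by rewrite addr0; field.
  have -> : (b *+ 2 - 0) / 2 = b by rewrite subr0; field.
  rewrite mulrCA; congr (_ * _).
  by apply/eqP; rewrite eq_complex /=; apply/andP; split; apply/eqP; ring.
set T := (\sum_j _).
set PE := \prod_j E j; set Ps := \prod_j (s j)%:C.
transitivity (PE * Ps - expi b * (sin b)%:C * (Complex 0 2 * T)).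
  by rewrite /T /PE /Ps; ring.
(* Each term carries the phase [expi (- ((t - a j) / 2))]. The real parts give the cosine sum; the
   imaginary parts, the weights having sum 1, add up to one copy of [Ps]. *)
have -> : Complex 0 2 * T
  = PE * ((\sum_j w j * cos ((t - a j) / 2) * \prod_(i | i != j) s i)%:C - 'i * Ps).
  have -> : 'i * Ps = \sum_j (w j)%:C * ('i * (s j)%:C * \prod_(i | i != j) (s i)%:C).
    transitivity (\sum_j (w j)%:C * ('i * Ps)).
      by rewrite -mulr_suml -rmorph_sum w1 mul1r.
    by apply: eq_bigr => j _; rewrite /Ps [in LHS](bigD1 j) //= !mulrA.
  rewrite rmorph_sum -sumrB /T !mulr_sumr; apply: eq_bigr => j _.
  rewrite !hornerE horner_prod; under eq_bigr do rewrite !hornerE Es.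
  rewrite big_split /= /PE [in RHS](bigD1 j) //= !rmorphM rmorph_prod /=.
  transitivity ((w j)%:C * (expi (a j) * Complex 0 2) *
    (\prod_(i | i != j) E i * \prod_(i | i != j) (s i)%:C)).
    by ring.
  rewrite eE /expi cosN sinN -/(s j).
  have -> : Complex (cos ((t - a j) / 2)) (- s j) = (cos ((t - a j) / 2))%:C - 'i * (s j)%:C.
    by apply/eqP; rewrite eq_complex /=; apply/andP; split; apply/eqP; ring.
  by ring.
rewrite /secular_trig -/s rmorphB !rmorphM rmorph_prod /=.
rewrite -/Ps -/PE; set K := (\sum_j _)%:C.
have key : 1 + 'i * (expi b * (sin b)%:C) = expi b * (cos b)%:C.
  apply/eqP; rewrite eq_complex /=; apply/andP; split; apply/eqP.
  by transitivity (1 - sin b ^+ 2); [ring | rewrite sin2cos2; ring].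
by ring.
transitivity (PE * ((1 + 'i * (expi b * (sin b)%:C)) * Ps - expi b * (sin b)%:C * K)).
  by ring.
by rewrite key; ring.
Qed.

End Secular.

(** * Roots of the secular function between consecutive nodes *)

Section Interlace.
Variable R : realType.

Lemma IVT_root (f : R -> R) (a b : R) : a < b -> continuous f -> f a * f b < 0 ->
  exists2 c, a < c < b & f c = 0.
Proof.
move=> ab fc fab.
have [||c] := @IVT R f a b 0 (ltW ab); first exact: continuous_subspaceT.
  rewrite ge_min le_max; case: (ltP 0 (f a)) fab => [fa|fa fab].
    by rewrite pmulr_rlt0 // => fb; rewrite (ltW fa) (ltW fb) orbT.
  by rewrite /=; apply/orP; right; apply/ltW; rewrite ltNge; apply/negP => fb;
    move: fab; rewrite ltNge mulr_le0 //.
rewrite in_itv /= => /andP[ac cb] fc0; exists c => //.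
rewrite !lt_neqAle ac cb !andbT; apply/andP; split; apply/eqP => e.
  by move: fab; rewrite e fc0 mul0r ltxx.
by move: fab; rewrite -e fc0 mulr0 ltxx.
Qed.

Lemma continuous_sum (T : topologicalType) (I : Type) (r : seq I) (P : pred I)
    (f : I -> T -> R) :
  (forall i, P i -> continuous (f i)) -> continuous (fun x => \sum_(i <- r | P i) f i x).
Proof. by move=> h x; apply: continuous_big => //; exact: add_continuous. Qed.

Lemma continuous_prod (T : topologicalType) (I : Type) (r : seq I) (P : pred I)
    (f : I -> T -> R) :
  (forall i, P i -> continuous (f i)) -> continuous (fun x => \prod_(i <- r | P i) f i x).
Proof. by move=> h x; apply: continuous_big => //; exact: mul_continuous. Qed.

Lemma continuous_secular_trig n (a w : 'I_n -> R) b : continuous (secular_trig a w b).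
Proof.
have half (c : R) : continuous (fun t : R => (t - c) / 2).
  by move=> t; apply: cvgMl; apply: cvgB; [exact: cvg_id | exact: cvg_cst].
have cs (c : R) : continuous (fun t : R => sin ((t - c) / 2)).
  by move=> t; apply: (continuous_comp (half c t)); exact: continuous_sin.
have cc (c : R) : continuous (fun t : R => cos ((t - c) / 2)).
  by move=> t; apply: (continuous_comp (half c t)); exact: continuous_cos.
move=> t; apply: cvgB; apply: cvgMr.
  by apply: continuous_prod => i _; exact: cs.
apply: continuous_sum => j _ u; apply: cvgM; first by apply: cvgMr; exact: cc.
by apply: continuous_prod => i _; exact: cs.
Qed.

Lemma secular_trig_at n (a w : 'I_n -> R) b t j : sin ((t - a j) / 2) = 0 ->
  secular_trig a w b t =
  - (sin b * (w j * cos ((t - a j) / 2))) * \prod_(i | i != j) sin ((t - a i) / 2).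
Proof.
move=> s0; rewrite /secular_trig (bigD1 j) //= s0 mul0r mulr0 sub0r.
rewrite (bigD1 j) //= [X in _ + X]big1 ?addr0 ?mulNr ?mulrA // => i ij.
by rewrite (bigD1 j) 1?eq_sym //= s0 mul0r mulr0.
Qed.

(** At a node only the product that skips it survives, and its sign alternates from one node to the
    next. The extra entry [A n.+1] closes the circle, so that the last arc is an interval like the
    others. *)
Lemma secular_roots n (A : nat -> R) (w : 'I_n.+1 -> R) b :
  (forall i j, (i < j <= n.+1)%N -> A i < A j) -> A n.+1 = A 0 + pi *+ 2 ->
  (forall j, 0 < w j) -> 0 < b < pi ->
  exists t : 'I_n.+1 -> R, forall j : 'I_n.+1, A j < t j < A j.+1 /\
    secular_trig (fun i : 'I_n.+1 => A i) w b (t j) = 0.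
Proof.
move=> Alt An w0 b0; have sb : 0 < sin b by exact: sin_gt0_pi.
set a := fun i : 'I_n.+1 => A i.
suff main : forall j : 'I_n.+1, exists c, A j < c < A j.+1 /\ secular_trig a w b c = 0.
  by have [t ht] := choice main; exists t.
have Ale i j : (i <= j <= n.+1)%N -> A i <= A j.
  by rewrite leq_eqVlt => /andP[/orP[/eqP->//|ij] jn]; rewrite ltW // Alt ?ij.
have spos i j : (i < j <= n.+1)%N -> (0 < i)%N || (j <= n)%N -> 0 < sin ((A j - A i) / 2).
  move=> /andP[ij jn] ijn; apply: sin_gt0_pi.
  have d0 : A i < A j by rewrite Alt ?ij.
  have d2 : A j - A i < pi *+ 2.
    rewrite ltrBlDr addrC -ltrBlDr; case/orP: ijn => ijn.
      have := Alt 0%N i; rewrite ijn (leq_trans (ltnW ij)) // => /(_ isT).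
      by have := Ale j n.+1; rewrite jn leqnn => /(_ isT); rewrite An; lra.
    have := Alt j n.+1; rewrite ltnS ijn leqnn => /(_ isT).
    have := Ale 0%N i; rewrite leq0n (leq_trans (ltnW ij)) // => /(_ isT).
    by rewrite An; lra.
  apply/andP; split; first by rewrite divr_gt0 // subr_gt0.
  by rewrite ltr_pdivrMr // mulr_natr.
have s00 (x : R) : sin ((x - x) / 2) = 0 by rewrite subrr mul0r sin0.
have c00 (x : R) : cos ((x - x) / 2) = 1 by rewrite subrr mul0r cos0.
move=> j; have [c hc fc] : exists2 c, A j < c < A j.+1 & secular_trig a w b c = 0; last by exists c.
apply: IVT_root; [by rewrite Alt // ltnSn /= ltn_ord | exact: continuous_secular_trig |].
rewrite (@secular_trig_at _ a w b (A j) j) // c00 mulr1.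
have [jn|jn] := ltnP j n.
  have j1 : (j.+1 < n.+1)%N by [].
  pose k := Ordinal j1.
  have jk : j != k by rewrite -val_eqE /= neq_ltn ltnSn.
  rewrite (@secular_trig_at _ a w b (A j.+1) k) // c00 mulr1.
  rewrite (bigD1 k) 1?eq_sym //= [X in _ * (_ * X)](bigD1 j) //=.
  set P1 := \prod_(_ | _) _; set P2 := \prod_(_ | _) _.
  (* Every remaining node lies on the same side of both neighbours [j] and [k], so the factors of
     [P1] and [P2] agree in sign one by one. *)
  have P12 : 0 < P1 * P2.
    rewrite /P1 /P2 [X in _ * X](eq_bigl (fun i => (i != j) && (i != k))); last by move=> i; rewrite andbC.
    rewrite -big_split /= prodr_gt0 // => i /andP[ij ik].
    have [lij|lij] := ltnP i j.
      by rewrite mulr_gt0 // spos ?lij ?(leqW lij) ?(ltnW jn) ?jn ?orbT //= ltnW // ltnW.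
    have lji : (j < i)%N by rewrite ltn_neqAle lij andbT eq_sym.
    have lki : (j.+1 < i)%N by rewrite ltn_neqAle lji andbT eq_sym.
    have i1 : (i <= n)%N by rewrite -ltnS ltn_ord.
    rewrite -[A j - A i]opprB -[A j.+1 - A i]opprB !mulNr !sinN mulrNN.
    by rewrite mulr_gt0 // spos ?lji ?lki ?i1 ?orbT //= leqW.
  have x0 : 0 < sin ((A j.+1 - A j) / 2) by rewrite spos // ?ltnSn ?jn ?orbT // ltn_ord.
  rewrite /a /= -[A j - A j.+1]opprB (mulNr (A j.+1 - A j)) sinN.
  rewrite [X in X < 0](_ : _ = - (sin b ^+ 2 * w j * w k *
    sin ((A j.+1 - A j) / 2) ^+ 2 * (P1 * P2))); last by ring.
  by rewrite oppr_lt0 mulr_gt0 // !mulr_gt0 ?exprn_gt0 ?w0.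
(* On the last arc the right end is node 0 one turn later; there the half-angle is [pi], and its
   cosine supplies the change of sign. *)
have ej : nat_of_ord j = n by apply/eqP; rewrite eqn_leq jn -ltnS ltn_ord.
have h2 : (A n.+1 - a ord0) / 2 = pi by rewrite An /a /=; field.
rewrite ej (@secular_trig_at _ a w b (A n.+1) ord0) ?h2 ?sinpi // cospi.
set P1 := \prod_(_ | _) _; set P2 := \prod_(_ | _) _.
have P10 : 0 < P1.
  apply: prodr_gt0 => i ij; rewrite spos //; last by rewrite leqnn orbT.
  rewrite leqnSn andbT ltn_neqAle -ltnS ltn_ord andbT.
  by apply: contra ij => /eqP e; apply/eqP/val_inj; rewrite /= ej.
have P20 : 0 < P2.
  apply: prodr_gt0 => i i0; rewrite spos ?leqnn ?andbT //.
  by rewrite lt0n -[_ == _]/(i == ord0) i0.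
rewrite [X in X < 0](_ : _ = - (sin b ^+ 2 * w j * w ord0 * (P1 * P2))); last by ring.
by rewrite oppr_lt0 !mulr_gt0 ?exprn_gt0.
Qed.

End Interlace.

(** * Lifted phases of a rank-one perturbation *)

Section SecularPhases.
Local Open Scope complex_scope.
Variable R : realType.

Lemma expi_sum (I : Type) (r : seq I) (P : pred I) (f : I -> R) :
  expi (\sum_(i <- r | P i) f i) = \prod_(i <- r | P i) expi (f i).
Proof. exact: (big_morph _ (@expiD R) (expi0 R)). Qed.

(** The values at 0 of both sides are compared, that is, the determinants. *)
Lemma secular_sum_phases n (a w a' : 'I_n -> R) b : \sum_j w j = 1 ->
  secular (fun j => expi (a j)) w (expi b - 1) = \prod_j ('X - (expi (a' j))%:P) ->
  expi (\sum_j a' j - \sum_j a j) = expi b.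
Proof.
move=> w1 /(congr1 (horner^~ 0)) /=.
rewrite horner_secular0 // horner_prod; under [RHS]eq_bigr do rewrite !hornerE.
rewrite addrC subrK !prodrN mulrCA => /(mulfI (expf_neq0 _ _)) h.
rewrite expiD !expi_sum -h ?oppr_eq0 ?oner_neq0 // -mulrA -expi_sum.
by rewrite [X in _ * X]mulrC expiN mulr1.
Qed.

Lemma secular_perm n (s : 'S_n) (e : 'I_n -> R[i]) w k :
  secular (fun i => e (s i)) (fun i => w (s i)) k = secular e w k.
Proof.
rewrite /secular [X in _ = X - _](reindex_inj (@perm_inj _ s)) /=; congr (_ - _ *: _).
rewrite [RHS](reindex_inj (@perm_inj _ s)) /=; apply: eq_bigr => j _; congr (_ *: _).
rewrite [RHS](reindex_inj (@perm_inj _ s)) /=; apply: eq_bigl => i.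
by rewrite (inj_eq perm_inj).
Qed.

Lemma secular_phases_sorted n (A : nat -> R) (w : 'I_n.+1 -> R) b :
  (forall i j, (i < j <= n.+1)%N -> A i < A j) -> A n.+1 = A 0 + pi *+ 2 ->
  (forall j, 0 < w j) -> \sum_j w j = 1 -> 0 < b < pi *+ 2 ->
  exists t : 'I_n.+1 -> R, [/\ forall j : 'I_n.+1, A j <= t j,
    \sum_j t j = \sum_(j < n.+1) A j + b &
    secular (fun j : 'I_n.+1 => expi (A j)) w (expi b - 1)
      = \prod_j ('X - (expi (t j))%:P)].
Proof.
move=> Alt An w0 w1 b0.
have b2 : b = (b / 2) *+ 2 by field.
have b20 : 0 < b / 2 < pi by move: b0; rewrite mulr2n; lra.
have [t ht] := secular_roots Alt An w0 b20; exists t.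
have tA i (j : 'I_n.+1) : (j < i <= n.+1)%N -> t j < A i.
  move=> /andP[ji iN]; have [/andP[_ h] _] := ht j; apply: (lt_le_trans h).
  by move: ji; rewrite leq_eqVlt => /orP[/eqP->//|ji]; rewrite ltW // Alt ?ji.
(* All [t j] lie in an open arc of one turn, so they give distinct points of the circle; as many as
   the degree, they exhaust the roots. *)
have inj : injective (fun j => expi (t j)).
  have main (i j : 'I_n.+1) : (i < j)%N -> expi (t i) <> expi (t j).
    move=> ij e; have : expi (t j - t i) = 1.
      by rewrite expiD -e mulrC expiN.
    have [/andP[h1 _] _] := ht i; have [/andP[h2 h2'] _] := ht j.
    have h3 : t i < A j by rewrite tA // ij ltnW.
    have h4 : A 0 <= A i.
      case: (nat_of_ord i) (ltn_ord i) => // k hk.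
      by rewrite ltW // Alt //= ltnW.
    have h5 : A j.+1 <= A n.+1.
      have := ltn_ord j; rewrite leq_eqVlt => /orP[/eqP->//|hj].
      by rewrite ltW // Alt // hj /=.
    move: h5; rewrite An => h5 /expi_eq1 h6.
    have : t j - t i = 0 by apply: h6; lra.
    by lra.
  move=> i j e; apply/val_inj; case: (ltngtP i j) => // ij; first by case: (main _ _ ij).
  by case: (main _ _ ij).
have eq : secular (fun j : 'I_n.+1 => expi (A j)) w (expi b - 1)
      = \prod_j ('X - (expi (t j))%:P).
  pose rs := [seq expi (t j) | j <- index_enum 'I_n.+1].
  rewrite [LHS](@all_roots_prod_XsubC _ _ rs).
  - by rewrite (monicP (secular_monic _ _ _)) scale1r big_map.
  - by rewrite size_secular size_map size_index_enum_ord.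
  - apply/allP => z /mapP[j _ ->]; rewrite rootE {1}b2 horner_secular //.
    by have [_ ->] := ht j; rewrite mulr0.
  - by rewrite uniq_rootsE map_inj_uniq // index_enum_uniq.
split => //.
  by move=> j; have [/andP[/ltW]] := ht j.
(* The determinant fixes the increase of the sum only modulo [pi *+ 2]. Interlacing places it
   strictly between 0 and [pi *+ 2], where [b] lies too. *)
have := secular_sum_phases w1 eq => h.
have h2 : \sum_j t j - \sum_(j < n.+1) A j - b = 0 -> \sum_j t j = \sum_(j < n.+1) A j + b.
  by move=> /eqP; rewrite subr_eq0 subr_eq addrC => /eqP.
have d0 : 0 < \sum_j t j - \sum_(j < n.+1) A j.
  rewrite -sumrB big_ord_recl ltr_wpDr ?sumr_ge0 // => [i _|].
    by have [/andP[/ltW]] := ht (lift ord0 i); rewrite subr_ge0.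
  by have [/andP[]] := ht ord0; rewrite subr_gt0.
have d2 : \sum_j t j - \sum_(j < n.+1) A j < pi *+ 2.
  have -> : pi *+ 2 = \sum_(j < n.+1) (A j.+1 - A j).
    by rewrite -(big_mkord xpredT (fun j => A j.+1 - A j)) telescope_sumr // An addrC addKr.
  rewrite -sumrB; apply: ltr_sum => [|i _].
    by apply/hasP; exists ord0; rewrite ?mem_index_enum.
  by have [/andP[_ h3] _] := ht i; rewrite ltrD2r.
have [bd|bd] := leP b (\sum_j t j - \sum_(j < n.+1) A j).
  apply: h2; apply: expi_eq1; first by lra.
  by rewrite expiD h mulrC expiN.
suff : b - (\sum_j t j - \sum_(j < n.+1) A j) = 0 by lra.
apply: expi_eq1; first by lra.
by rewrite expiD -h mulrC expiN.
Qed.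

Lemma sorting_perm n (r : 'I_n -> R) : injective r ->
  exists s : 'S_n, forall i j : 'I_n, (i < j)%N -> r (s i) < r (s j).
Proof.
move=> rI; pose T := [tuple r i | i < n].
have /tuple_permP[s hs] : perm_eq (sort <=%R T) T by rewrite perm_sort.
exists s => i j ij.
have sz : size (sort <=%R T) = n by rewrite size_sort size_tuple.
have nE (k : 'I_n) : nth 0 (sort <=%R T) k = r (s k).
  by rewrite hs -tnth_nth !tnth_mktuple.
rewrite -!nE lt_sorted_ltn_nth ?inE ?sz // sort_lt_sorted.
by rewrite map_inj_uniq // enum_uniq.
Qed.

Lemma secular_phases_distinct n (a w : 'I_n.+1 -> R) b :
  injective (fun j => expi (a j)) ->
  (forall j, 0 < w j) -> \sum_j w j = 1 -> 0 < b < pi *+ 2 ->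
  exists t : 'I_n.+1 -> R, [/\ forall j, a j <= t j,
    \sum_j t j = \sum_j a j + b &
    secular (fun j => expi (a j)) w (expi b - 1) = \prod_j ('X - (expi (t j))%:P)].
Proof.
move=> aI w0 w1 b0.
have [m hm] := choice (fun j => phase_reduce (a j)).
pose r j := a j + pi *+ 2 *~ m j.
have er j : expi (r j) = expi (a j) by rewrite expi_int_period.
have rI : injective r by move=> i j /(congr1 (@expi R)); rewrite !er => /aI.
have [s hs] := sorting_perm rI.
pose A k := if (k < n.+1)%N then r (s (inord k)) else r (s ord0) + pi *+ 2.
have AE (j : 'I_n.+1) : A j = r (s j) by rewrite /A ltn_ord inord_val.
have AE0 : A 0%N = r (s ord0) by exact: (AE ord0).
have An : A n.+1 = A 0%N + pi *+ 2 by rewrite AE0 /A ltnn.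
have Alt i j : (i < j <= n.+1)%N -> A i < A j.
  move=> /andP[ij]; rewrite leq_eqVlt => /orP[/eqP jn|jn].
    have iN : (i < n.+1)%N by rewrite -jn.
    rewrite jn An AE0 (AE (Ordinal iN)).
    have := hm (s (Ordinal iN)); have := hm (s ord0); rewrite -!/(r _).
    by move=> /andP[h1 h2] /andP[h3 h4]; lra.
  have im := ltn_trans ij jn.
  by rewrite (AE (Ordinal jn)) (AE (Ordinal im)) hs.
have ws1 : \sum_j w (s j) = 1 by rewrite -w1 [RHS](reindex_inj (@perm_inj _ s)).
have [t [tA ts te]] := secular_phases_sorted Alt An (fun j => w0 (s j)) ws1 b0.
pose s' := (s^-1)%g.
(* Subtracting the turns added by the reduction returns to the given lifts [a]. *)
exists (fun j => t (s' j) - pi *+ 2 *~ m j); split.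
- move=> j; have := tA (s' j); rewrite AE permKV /r; lra.
- have sA : \sum_(j < n.+1) A j = \sum_j r j.
    by rewrite [RHS](reindex_inj (@perm_inj _ s)); apply: eq_bigr => j _; rewrite AE.
  have st : \sum_j t (s' j) = \sum_j t j.
    by rewrite (reindex_inj (@perm_inj _ s)); apply: eq_bigr => j _; rewrite /s' permK.
  by rewrite sumrB st ts sA /r big_split /=; ring.
rewrite -(secular_perm s).
transitivity (secular (fun j : 'I_n.+1 => expi (A j)) (fun j => w (s j)) (expi b - 1)).
  by congr secular; apply/funext => j; rewrite AE er.
rewrite te [RHS](reindex_inj (@perm_inj _ s)) /=; apply: eq_bigr => j _.
by rewrite permK -mulrNz expi_int_period.
Qed.

(** Weight zero means that [v] is orthogonal to the eigenvector, whose eigenvalue then survives. *)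
Lemma secular_lift n (e : 'I_n.+1 -> R[i]) w k j : w j = 0 ->
  secular e w k = ('X - (e j)%:P) * secular (fun i => e (lift j i)) (fun i => w (lift j i)) k.
Proof.
move=> wj; rewrite /secular (bigD1_ord j) //= mulrBr; congr (_ - _).
rewrite -scalerAr mulr_sumr (bigD1_ord j) //= wj mul0r scale0r add0r.
congr (_ *: _); apply: eq_bigr => i _; rewrite -scalerAr; congr (_ *: _).
rewrite (bigD1_ord j) ?neq_lift //=; congr (_ * _); apply: eq_bigl => l.
by rewrite (inj_eq lift_inj).
Qed.

(** Algebraic form of a change of basis inside an eigenspace: the component of [v] is aligned with
    one basis vector, leaving weight zero on the other. *)
Lemma secular_pool n (e : 'I_n -> R[i]) w k i j : i != j -> e i = e j ->
  secular e w k =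
  secular e (fun l => if l == i then w i + w j else if l == j then 0 else w l) k.
Proof.
move=> ij eij; have ji : j != i by rewrite eq_sym.
rewrite /secular; congr (_ - _ *: _).
rewrite (bigD1 i) //= [in RHS](bigD1 i) //= eqxx [X in _ + X = _](bigD1 j) //=.
rewrite [X in _ = _ + X](bigD1 j) //= eqxx (negPf ji).
rewrite mul0r scale0r add0r addrA; congr (_ + _); last first.
  by apply: eq_bigr => l /andP[/negPf-> /negPf->].
rewrite [\prod_(_ | _ != i) _](bigD1 j) //=.
rewrite [\prod_(_ | _ != j) _](bigD1 i) //=.
under [X in _ + _ *: (_ * X)]eq_bigl do rewrite andbC.
by rewrite eij -scalerDl -mulrDl -rmorphD.
Qed.

(* Zero weights and coinciding points split off a linear factor, so that only the case of distinct
   points with positive weights needs the intermediate value theorem. *)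
Lemma secular_phases n (a w : 'I_n -> R) b :
  (forall j, 0 <= w j) -> \sum_j w j = 1 -> 0 <= b < pi *+ 2 ->
  exists t : 'I_n -> R, [/\ forall j, a j <= t j,
    \sum_j t j = \sum_j a j + b &
    secular (fun j => expi (a j)) w (expi b - 1) = \prod_j ('X - (expi (t j))%:P)].
Proof.
elim: n a w => [|n IH] a w w0 w1 /andP[b0 b2].
  by move/eqP: w1; rewrite big_ord0 eq_sym oner_eq0.
move: b0; rewrite le_eqVlt => /orP[/eqP <-|b0].
  exists a; split=> //; first by rewrite addr0.
  by rewrite /secular expi0 subrr scale0r subr0.
have zero (u : 'I_n.+1 -> R) j : (forall j, 0 <= u j) -> \sum_j u j = 1 -> u j = 0 ->
  exists t : 'I_n.+1 -> R, [/\ forall j, a j <= t j,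
    \sum_j t j = \sum_j a j + b &
    secular (fun j => expi (a j)) u (expi b - 1) = \prod_j ('X - (expi (t j))%:P)].
  move=> u0 u1 uj.
  have u1' : \sum_i u (lift j i) = 1 by rewrite -u1 [RHS](bigD1_ord j) //= uj add0r.
  have [|t [ta ts te]] := IH (fun i => a (lift j i)) _ (fun i => u0 (lift j i)) u1'.
    by rewrite (ltW b0).
  pose t' i := if unlift j i is Some k then t k else a j.
  have t'j : t' j = a j by rewrite /t' unlift_none.
  have t'l k : t' (lift j k) = t k by rewrite /t' liftK.
  exists t'; split.
  - by move=> i; case: (unliftP j i) => [k|] ->; rewrite ?t'j ?t'l ?ta.
  - rewrite (bigD1_ord j) //= t'j; under eq_bigr do rewrite t'l.
    by rewrite ts [in RHS](bigD1_ord j) //= addrA.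
  - rewrite (secular_lift _ _ uj) te [RHS](bigD1_ord j) //= t'j.
    by congr (_ * _); apply: eq_bigr => k _; rewrite t'l.
have [[j wj]|/forallNP wn0] := pselect (exists j, w j = 0); first exact: zero wj.
have [[i [j [ij eij]]]|dist] := pselect (exists i j, i != j /\ expi (a i) = expi (a j)).
  have ji : j != i by rewrite eq_sym.
  rewrite (secular_pool _ _ ij eij); apply: (zero _ j).
  - by move=> l; case: ifP => _; [rewrite addr_ge0 | case: ifP].
  - rewrite -w1 (bigD1 i) //= eqxx [in RHS](bigD1 i) //=.
    rewrite (bigD1 j) //= eqxx (negPf ji) add0r.
    rewrite [in RHS](bigD1 j) //= addrA; congr (_ + _).
    by apply: eq_bigr => l /andP[/negPf-> /negPf->].
  - by rewrite (negPf ji) eqxx.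
apply: secular_phases_distinct => //; last by rewrite b0.
  move=> i j eij; apply/eqP/negPn/negP => ij; apply: dist; by exists i, j.
by move=> j; rewrite lt_neqAle w0 andbT eq_sym; apply/eqP/wn0.
Qed.

End SecularPhases.

(** * Characteristic polynomials and normal matrices *)

Section CharPoly.
Local Open Scope sesquilinear_scope.

Lemma char_poly_similar (K : comNzRingType) n (P A Q : 'M[K]_n) :
  P *m Q = 1%:M -> char_poly (P *m A *m Q) = char_poly A.
Proof.
move=> PQ; rewrite /char_poly.
have PQ' : map_mx polyC P *m map_mx polyC Q = 1%:M by rewrite -map_mxM PQ map_mx1.
have -> : char_poly_mx (P *m A *m Q) =
    map_mx polyC P *m char_poly_mx A *m map_mx polyC Q.
  rewrite /char_poly_mx mulmxBr mulmxBl !map_mxM; congr (_ - _).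
  by rewrite mul_mx_scalar -scalemxAl PQ' scalemx1.
by rewrite !det_mulmx mulrAC -det_mulmx PQ' det1 mul1r.
Qed.

Lemma char_poly_diag (K : comNzRingType) n (d : 'rV[K]_n) :
  char_poly (diag_mx d) = \prod_j ('X - (d 0 j)%:P).
Proof.
rewrite char_poly_trig; last exact: diag_mx_is_trig.
by apply: eq_bigr => j _; rewrite mxE eqxx.
Qed.

(** The matrix determinant lemma without inverses: [E] is the adjugate of [diag_mx d], and two
    eliminations compute the determinant of the bordered matrix [B]. *)
Lemma det_diag_rank1 (K : idomainType) n (d : 'rV[K]_n) (u : 'cV_n) (v : 'rV_n) :
  \prod_j d 0 j != 0 ->
  \det (diag_mx d + u *m v) =
  \prod_j d 0 j + \sum_j u j 0 * v 0 j * \prod_(i | i != j) d 0 i.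
Proof.
move=> d0; set P := \prod_j _.
pose B : 'M[K]_(1 + n) := block_mx 1%:M v (- u) (diag_mx d).
have B1 : \det B = \det (diag_mx d + u *m v).
  have -> : B = block_mx 1%:M 0 (- u) 1%:M *m block_mx (1%:M : 'M[K]_1) v 0 (diag_mx d + u *m v).
    rewrite mulmx_block !mul1mx !mul0mx !mulmx1 !addr0 mulNmx.
    by rewrite [X in block_mx _ _ _ X]addrC addrK.
  by rewrite det_mulmx det_lblock det_ublock !det1 !mul1r.
pose E := diag_mx (\row_j \prod_(i | i != j) d 0 i).
have DE : diag_mx d *m E = P%:M.
  rewrite mulmx_diag -diag_const_mx; congr diag_mx; apply/rowP => j.
  by rewrite !mxE /P [in RHS](bigD1 j).
have B2 : B *m block_mx P%:M 0 (E *m u) 1%:M = block_mx (P%:M + v *m (E *m u)) v 0 (diag_mx d).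
  rewrite mulmx_block !mul1mx !mulmx1 !mulmx0 !add0r (mulmxA (diag_mx d)) DE.
  by rewrite mulNmx mul_mx_scalar mul_scalar_mx addNr.
have := congr1 determinant B2.
rewrite det_mulmx det_lblock det_ublock det_diag det1 mulr1 det_scalar1 B1 => /(mulIf d0) ->.
rewrite det_mx11 mxE mxE eqxx mulr1n; congr (_ + _).
rewrite mxE; apply: eq_bigr => j _; rewrite mul_diag_mx !mxE.
by ring.
Qed.

Lemma char_poly_diag_rank1 (K : idomainType) n (d : 'rV[K]_n) (u : 'cV_n) (v : 'rV_n) :
  char_poly (diag_mx d + u *m v) = \prod_j ('X - (d 0 j)%:P)
   - \sum_j (u j 0 * v 0 j) *: \prod_(i | i != j) ('X - (d 0 i)%:P).
Proof.
rewrite /char_poly /char_poly_mx.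
have -> : 'X%:M - map_mx polyC (diag_mx d + u *m v) =
   diag_mx (\row_j ('X - (d 0 j)%:P)) + (- map_mx polyC u) *m map_mx polyC v.
  rewrite map_mxD map_mxM opprD addrA mulNmx; congr (_ - _).
  rewrite map_diag_mx -diag_const_mx -raddfB /=; congr diag_mx.
  by apply/rowP => j; rewrite !mxE.
rewrite det_diag_rank1; last first.
  by under eq_bigr do rewrite mxE; rewrite monic_neq0 // monic_prod_XsubC.
under eq_bigr do rewrite mxE; congr (_ + _); rewrite -sumrN; apply: eq_bigr => j _.
under eq_bigr do rewrite mxE.
by rewrite !mxE mulNr mulNr -polyCM mul_polyC.
Qed.

Lemma prod_XsubC_perm (K : fieldType) n (f g : 'I_n -> K) :
  \prod_j ('X - (f j)%:P) = \prod_j ('X - (g j)%:P) ->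
  exists s : 'S_n, forall j, f j = g (s j).
Proof.
move=> fg.
have h (h : 'I_n -> K) : \prod_j ('X - (h j)%:P) = \prod_(x <- [tuple h j | j < n]) ('X - x%:P).
  by rewrite /= big_map big_enum.
have /tuple_permP[s hs] : perm_eq [tuple f j | j < n] [tuple g j | j < n].
  by apply: prod_XsubC_eq; rewrite -!h.
exists s => j; have := congr1 (nth 0 ^~ j) hs.
by rewrite -!tnth_nth !tnth_mktuple.
Qed.

End CharPoly.

(** * Diagonalization of normal matrices *)

Section Normal.
Local Open Scope sesquilinear_scope.
Variable C : numClosedFieldType.

(** The spectral theorem lists the eigenvalues in an order of its own; permuting the eigenvectors
    realizes the order prescribed by [c]. *)
Lemma normal_diag n (A : 'M[C]_n) (c : 'I_n -> C) : A \is normalmx ->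
  char_poly A = \prod_j ('X - (c j)%:P) ->
  exists2 S : 'M[C]_n, S \is unitarymx & A = S^t* *m diag_mx (\row_j c j) *m S.
Proof.
move=> /orthomx_spectralP; set P := spectralmx A; set d := spectral_diag A.
have Pu : P \is unitarymx := spectral_unitarymx A.
rewrite invmx_unitary // => eA.
have PP : P^t* *m P = 1%:M by rewrite -[LHS]mul1mx mulmxA mulmxKtV.
rewrite {1}eA char_poly_similar // char_poly_diag => /prod_XsubC_perm[s hs].
exists (row_perm s^-1 P).
  rewrite row_permE mul_unitarymx //; apply/unitarymxP.
  by rewrite tr_perm_mx map_perm_mx -perm_mxM mulgV perm_mx1.
rewrite eA; apply/matrixP => i j; rewrite !mul_mx_diag !mxE.
rewrite [RHS](reindex_inj (@perm_inj _ s)) /=; apply: eq_bigr => k _.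
by rewrite !mxE permK hs.
Qed.

Lemma unitary_normal n (U : 'M[C]_n) : U \is unitarymx -> U \is normalmx.
Proof.
move=> Uu; apply/normalmxP; rewrite (unitarymxP Uu).
by rewrite -[RHS]mul1mx mulmxA mulmxKtV.
Qed.

End Normal.

(** * Phases of unitary matrices *)

Section PhaseShift.
Local Open Scope sesquilinear_scope.
Local Open Scope complex_scope.
Variable R : realType.
Local Notation C := R[i].

(* The phases are lifts to [R] of the arguments of the eigenvalues: they are neither sorted nor
   reduced modulo [2 pi]. *)
Definition has_phases n (U : 'M[C]_n) (a : 'I_n -> R) : Prop :=
  char_poly U = \prod_j ('X - (expi (a j))%:P).

(** For unitary [S], the exponential of [i] times the Hermitian matrix with eigenvalues [g j] in the
    basis given by the rows of [S]. *)
Definition phase_mx n (S : 'M[C]_n) (g : 'I_n -> R) : 'M[C]_n :=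
  S^t* *m diag_mx (\row_j expi (g j)) *m S.

Lemma conjC_expi (t : R) : Num.conj (expi t) = expi (- t).
Proof. exact: expi_conj. Qed.

Lemma unitarymx_tmulC n (S : 'M[C]_n) : S \is unitarymx -> S^t* *m S = 1%:M.
Proof. by move=> Su; rewrite -[LHS]mul1mx mulmxA (mulmxKtV _ Su). Qed.

Lemma phase_mxD n (S : 'M[C]_n) g h : S \is unitarymx ->
  phase_mx S g *m phase_mx S h = phase_mx S (fun j => g j + h j).
Proof.
move=> Su; rewrite /phase_mx !mulmxA (mulmxtVK _ Su) -[X in X *m S]mulmxA mulmx_diag.
rewrite (_ : \row_j (_ * _) = \row_j expi (g j + h j)) //.
by apply/rowP => j; rewrite !mxE expiD.
Qed.

Lemma diag_expi_unitary n (g : 'I_n -> R) : diag_mx (\row_j expi (g j)) \is @unitarymx C n n.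
Proof.
apply/unitarymxP; rewrite tr_diag_mx map_diag_mx mulmx_diag -diag_const_mx.
by congr diag_mx; apply/rowP => j; rewrite !mxE /= conjC_expi mulrC expiN.
Qed.

Lemma phase_mx_unitary n (S : 'M[C]_n) g : S \is unitarymx -> phase_mx S g \is unitarymx.
Proof.
move=> Su; have Sc : S^t* \is unitarymx by rewrite trmxC_unitary.
exact: (mul_unitarymx (mul_unitarymx Sc (diag_expi_unitary g)) Su).
Qed.

Lemma phase_mx0 n (S : 'M[C]_n) : S \is unitarymx -> phase_mx S (fun=> 0) = 1%:M.
Proof.
move=> Su; rewrite /phase_mx -[RHS](unitarymx_tmulC Su).
have -> : \row_(j < n) expi (0 : R) = const_mx 1 by apply/rowP => j; rewrite !mxE expi0.
by rewrite diag_const_mx mulmx1.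
Qed.

Lemma row_unitarymx n (S : 'M[C]_n) j : S \is unitarymx ->
  row j S *m (row j S)^t* = 1%:M.
Proof.
move=> /unitarymxP Su; apply/matrixP => i k; rewrite !ord1 [RHS]mxE eqxx.
transitivity ((S *m S^t*) j j); last by rewrite Su mxE eqxx.
by rewrite [LHS]mxE [RHS]mxE; apply: eq_bigr => l _; rewrite !mxE.
Qed.

Lemma unitary_phase_mx n (U : 'M[C]_n) a : U \is unitarymx -> has_phases U a ->
  exists2 S : 'M[C]_n, S \is unitarymx & U = phase_mx S a.
Proof. by move=> Uu Ua; apply: normal_diag => //; exact: unitary_normal. Qed.

(** In an eigenbasis of [U] the perturbation is still of rank one, and only the squared moduli [w j]
    of the coordinates [y] of [v] enter the characteristic polynomial. *)
Lemma phase_shift_rank1 n (U : 'M[C]_n) a (v : 'rV[C]_n) b :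
  U \is unitarymx -> has_phases U a -> v *m v^t* = 1%:M -> 0 <= b < pi *+ 2 ->
  exists t : 'I_n -> R, [/\ forall j, a j <= t j, \sum_j t j = \sum_j a j + b &
    has_phases (U *m (1%:M + (expi b - 1) *: (v^t* *m v))) t].
Proof.
move=> Uu Ua v1 b0; have [S Su ->] := unitary_phase_mx Uu Ua.
pose D := diag_mx (\row_j expi (a j)); set k := expi b - 1; pose y := v *m S^t*.
have yE : y^t* = S *m v^t* by rewrite /y trmx_mul map_mxM trmxCK.
have y1 : y *m y^t* = 1%:M.
  by rewrite yE /y mulmxA mulmxKtV.
pose w j : R := complex.Re (y 0 j * conjc (y 0 j)).
have wE j : (w j)%:C = y 0 j * conjc (y 0 j).
  by rewrite /w RRe_real // ger0_real // mulcJ_ge0.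
have w0 j : 0 <= w j by rewrite -ler0c wE mulcJ_ge0.
have w1 : \sum_j w j = 1.
  apply: complexI; rewrite rmorph_sum; transitivity ((y *m y^t*) 0 0).
    by rewrite mxE; apply: eq_bigr => j _; rewrite /= wE !mxE.
  by rewrite y1 mxE eqxx.
have [t [ta ts te]] := secular_phases a w0 w1 b0.
exists t; split=> //; rewrite /has_phases -te.
have -> : phase_mx S a *m (1%:M + k *: (v^t* *m v)) = S^t* *m (D + (k *: (D *m y^t*)) *m y) *m S.
  rewrite /phase_mx -/D mulmxDr mulmx1 mulmxDr mulmxDl; congr (_ + _).
  rewrite -scalemxAr -scalemxAl -scalemxAr -scalemxAl; congr (_ *: _).
  by rewrite yE /y !mulmxA (mulmxKtV _ Su).
rewrite (char_poly_similar _ (unitarymx_tmulC Su)).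
rewrite char_poly_diag_rank1 /secular scaler_sumr.
under eq_bigr do rewrite mxE; congr (_ - _); apply: eq_bigr => j _.
rewrite scalerA; congr (_ *: _); last by apply: eq_bigr => i _; rewrite mxE.
have yc : (y^t*) j 0 = conjc (y 0 j) by rewrite !mxE.
by rewrite mxE mul_diag_mx mxE yc mxE wE /k; ring.
Qed.

Lemma rank1_phase_mx n (S : 'M[C]_n) j b : S \is unitarymx ->
  phase_mx S (fun i => if i == j then b else 0) =
  1%:M + (expi b - 1) *: ((row j S)^t* *m row j S).
Proof.
move=> Su; have SS := unitarymx_tmulC Su.
rewrite -[X in _ = X + _]SS /phase_mx; apply/matrixP => i l.
transitivity (\sum_k (S^t*) i k * expi (if k == j then b else 0) * S k l).
  by rewrite mul_mx_diag mxE; apply: eq_bigr => k _; rewrite !mxE.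
transitivity (\sum_k (S^t*) i k * S k l + (expi b - 1) * ((S^t*) i j * S j l)); last first.
  have -> : (S^t*) i j * S j l = ((row j S)^t* *m row j S) i l.
    by rewrite [in RHS]mxE big_ord1 !mxE.
  set T := (row j S)^t* *m row j S.
  rewrite [RHS]mxE; congr (_ + _).
    by rewrite [RHS]mxE.
  by rewrite [RHS]mxE.
rewrite (bigD1 j) //= eqxx [X in _ = X + _](bigD1 j) //= addrAC; congr (_ + _); first by ring.
by apply: eq_bigr => k /negPf->; rewrite expi0 mulr1.
Qed.

Lemma phase_shift n (U S : 'M[C]_n) a g :
  U \is unitarymx -> has_phases U a -> S \is unitarymx -> (forall j, 0 <= g j < pi *+ 2) ->
  exists t : 'I_n -> R, [/\ forall j, a j <= t j, \sum_j t j = \sum_j a j + \sum_j g j &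
    has_phases (U *m phase_mx S g) t].
Proof.
move=> Uu Ua Su g0.
(* Coordinates are rotated one at a time: each rotation is a rank-one factor, and factors with the
   same [S] multiply by adding phases. *)
suff main (r : seq 'I_n) : uniq r -> exists t : 'I_n -> R,
    [/\ forall j, a j <= t j, \sum_j t j = \sum_j a j + \sum_(j <- r) g j &
    has_phases (U *m phase_mx S (fun j => if j \in r then g j else 0)) t].
  have [t [ta ts te]] := main _ (index_enum_uniq 'I_n).
  have eg : (fun j => if j \in index_enum 'I_n then g j else 0) = g.
    by apply/funext => j; rewrite mem_index_enum.
  by exists t; split; [exact: ta | exact: ts | move: te; rewrite eg].
elim: r => [_|j r IH /= /andP[jr /IH[t [ta ts te]]]].
  exists a; split; [by [] | by rewrite big_nil addr0 |].
  by rewrite [phase_mx _ _]phase_mx0 // mulmx1.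
have Mu (g' : 'I_n -> R) : U *m phase_mx S g' \is unitarymx.
  exact: (mul_unitarymx Uu (phase_mx_unitary g' Su)).
have [t' [ta' ts' te']] := phase_shift_rank1 (Mu _) te (row_unitarymx j Su) (g0 j).
exists t'; split.
- by move=> i; apply: le_trans (ta' i).
- by rewrite ts' ts big_cons; ring.
have eg : (fun i => (if i \in r then g i else 0) + (if i == j then g j else 0)) =
    (fun i => if i \in j :: r then g i else 0).
  apply/funext => i; rewrite in_cons.
  by case: eqVneq => [->|_]; rewrite ?(negPf jr) ?add0r ?addr0.
by move: te'; rewrite -(rank1_phase_mx _ _ Su) -mulmxA (phase_mxD _ _ Su) eg.
Qed.

End PhaseShift.

(** * Optimal pairing on the circle *)

Section Exchange.
Variable R : realType.

(** Since [max p x = p + (x - p)_+] and the positive part is convex, of two pairs of differences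
    with equal sums the less spread one gives less. The hypotheses make [x - p] the largest of the
    four differences; [max_swap] rests on the same principle. *)
Lemma max_wrap (T p q x y : R) : p - q <= T -> T <= x - y ->
  Num.max p (y + T) + Num.max q (x - T) <= Num.max p x + Num.max q y.
Proof.
move=> pq xy; case: (leP p (y + T)) => ?; case: (leP q (x - T)) => ?;
  by case: (leP p x) => ?; case: (leP q y) => ?; lra.
Qed.

Lemma max_swap (p q u v : R) : p <= q -> u <= v ->
  Num.max q v + Num.max p u <= Num.max q u + Num.max p v.
Proof.
move=> pq uv; case: (leP q v) => ?; case: (leP p u) => ?;
  by case: (leP q u) => ?; case: (leP p v) => ?; lra.
Qed.

Lemma sum_max_perm n (a d : 'I_n -> R) (s : 'S_n) :
  (forall i j, 0 <= (d i - d j) * (a i - a j)) ->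
  \sum_k Num.max (a k) (d k) <= \sum_k Num.max (a k) (d (s k)).
Proof.
move=> com; have [N] := ubnP #|[set k | s k != k]|.
elim: N s => // N IH s; rewrite ltnS => sN.
have [k0 k0P|s1] := pickP (fun k => s k != k); last first.
  by apply: ler_sum => k _; rewrite (eqP (negbFE (s1 k))).
(* For comonotone [a] and [d], an index minimizing [a k + d k] minimizes both at once. *)
have [j sj jmin] : exists2 j, s j != j & forall k, s k != k -> d j <= d k /\ a j <= a k.
  case: (@arg_minP _ _ _ k0 (fun k => s k != k) (fun k => a k + d k) k0P) => j sj jmin; exists j => // k sk.
  have := jmin k sk; have := com j k => cjk ajk.
  by split; rewrite leNgt; apply/negP => lt; nra.
set i := (s^-1)%g j.
have si : s i = j by rewrite permKV.
have ij : i != j by apply: contra sj => /eqP e; rewrite -{1}e si.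
pose s' := (tperm i j * s)%g.
have s'j : s' j = j by rewrite permM tpermR si.
have s'i : s' i = s j by rewrite permM tpermL.
have s'k k : k != i -> k != j -> s' k = s k.
  by move=> ki kj; rewrite permM tpermD // eq_sym.
apply: (le_trans (IH s' _)).
  apply: leq_trans sN; apply: proper_card; apply/properP; split.
    apply/fintype.subsetP => k; rewrite !inE.
    have [->|kj] := eqVneq k j; first by rewrite s'j eqxx.
    have [->|ki] := eqVneq k i; first by rewrite si [j == i]eq_sym ij.
    by rewrite s'k.
  by exists j; rewrite !inE // s'j eqxx.
rewrite (bigD1 i) //= [X in _ <= X](bigD1 i) //=.
have ji : j != i by rewrite eq_sym.
rewrite (bigD1 j) //= [X in _ <= _ + X](bigD1 j) //= !addrA lerD //; last first.
  by apply: ler_sum => k /andP[ki kj]; rewrite s'k.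
rewrite s'i s'j si; apply: max_swap.
  by have [] := jmin i; rewrite // si eq_sym.
by have [] := jmin (s j) => //; rewrite (inj_eq perm_inj).
Qed.

(* Among all ways of lifting and pairing the points [d] of the circle with total winding [0],
   the monotone one minimizes the sum; any other is improved by exchanging two entries. *)
Lemma sum_max_wrap n (a d : 'I_n -> R) (s : 'S_n) (m : 'I_n -> int) (T : R) :
  (forall i j, 0 <= (d i - d j) * (a i - a j)) -> 0 <= T ->
  (forall i j, a i - a j <= T) -> (forall i j, d i - d j <= T) ->
  \sum_k m k = 0 ->
  \sum_k Num.max (a k) (d k) <= \sum_k Num.max (a k) (d (s k) + T *~ m k).
Proof.
move=> com T0 aT dT; have [N] := ubnP (\sum_k `|m k|)%N.
elim: N s m => // N IH s m; rewrite ltnS => mN m0.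
have [i mi|mle0] := pickP (fun k => 0 < m k); last first.
  have mk0 k : m k = 0.
    apply/eqP; rewrite -oppr_eq0; move: k.
    have /eqP : \sum_k - m k = 0 by rewrite sumrN m0 oppr0.
    rewrite psumr_eq0 => [/allP h k|k _]; first by apply: h; rewrite mem_index_enum.
    by rewrite oppr_ge0 leNgt mle0.
  under [X in _ <= X]eq_bigr do rewrite mk0 mulr0z addr0.
  exact: sum_max_perm.
have [j mj|mge0] := pickP (fun k => m k < 0); last first.
  have /eqP : \sum_k m k = 0 by [].
  rewrite psumr_eq0 => [/allP/(_ i (mem_index_enum _))/=/eqP mi0|k _].
    by move: mi; rewrite mi0 ltxx.
  by rewrite leNgt mge0.
have ji : j != i by apply/eqP => e; move: mj; rewrite e ltNge ltW.
pose s' := (tperm i j * s)%g.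
have s'j : s' j = s i by rewrite permM tpermR.
have s'i : s' i = s j by rewrite permM tpermL.
have s'k k : k != i -> k != j -> s' k = s k.
  by move=> ki kj; rewrite permM tpermD // eq_sym.
(* Two entries trade places and one turn passes from the positive count to the negative one: the
   total stays 0 and the sum of absolute values drops by 2. *)
pose m' k := if k == i then m j + 1 else if k == j then m i - 1 else m k.
have m'i : m' i = m j + 1 by rewrite /m' eqxx.
have m'j : m' j = m i - 1 by rewrite /m' eqxx (negPf ji).
have m'k k : k != i -> k != j -> m' k = m k by rewrite /m' => /negPf-> /negPf->.
apply: (le_trans (IH s' m' _ _)).
- apply: leq_trans mN; rewrite (bigD1 i) //= [X in (_ < X)%N](bigD1 i) //=.
  rewrite (bigD1 j) //= [X in (_ < _ + X)%N](bigD1 j) //= !addnA.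
  rewrite (eq_bigr (fun k => `|m k|)%N) => [|k /andP[ki kj]]; last by rewrite m'k.
  by rewrite ltn_add2r m'i m'j; lia.
- rewrite -[RHS]m0 (bigD1 i) //= [X in _ = X](bigD1 i) //=.
  rewrite (bigD1 j) //= [X in _ = _ + X](bigD1 j) //= !addrA; congr (_ + _).
    by rewrite m'i m'j; ring.
  by apply: eq_bigr => k /andP[ki kj]; rewrite m'k.
rewrite (bigD1 i) //= [X in _ <= X](bigD1 i) //=.
rewrite (bigD1 j) //= [X in _ <= _ + X](bigD1 j) //= !addrA lerD //; last first.
  by apply: ler_sum => k /andP[ki kj]; rewrite s'k // m'k.
rewrite s'i s'j m'i m'j mulrzDr mulrzBr mulr1z !addrA.
(* The counts separate the two entries by at least [2 T], of which the spread of [d] takes back at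
   most [T]. *)
apply: max_wrap => //.
have h1 : T <= T *~ m i by rewrite -mulrzr ler_peMr // -[1]/(1%:~R) ler_int.
have h2 : T *~ m j <= - T.
  by rewrite -[T *~ _]opprK -mulrNz lerN2 -mulrzr ler_peMr // -[1]/(1%:~R) ler_int; lia.
have := dT (s j) (s i); lra.
Qed.

End Exchange.

(** * Lidskii inequality for products of unitary matrices *)

Section Lidskii.
Local Open Scope sesquilinear_scope.
Local Open Scope complex_scope.
Variable R : realType.
Local Notation C := R[i].

Lemma phase_mxZ n (S : 'M[C]_n) g c :
  phase_mx S (fun j => g j + c) = expi c *: phase_mx S g.
Proof.
rewrite /phase_mx (_ : diag_mx _ = expi c *: diag_mx (\row_j expi (g j))).
  by rewrite -scalemxAr -scalemxAl.
by rewrite -linearZ; congr diag_mx; apply/rowP => j; rewrite !mxE addrC expiD.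
Qed.

Lemma phase_mx_phases n (S : 'M[C]_n) g : S \is unitarymx -> has_phases (phase_mx S g) g.
Proof.
move=> Su; rewrite /has_phases /phase_mx (char_poly_similar _ (unitarymx_tmulC Su)).
by rewrite char_poly_diag; apply: eq_bigr => j _; rewrite mxE.
Qed.

Lemma has_phases_shift n (U : 'M[C]_n) a c : U \is unitarymx -> has_phases U a ->
  has_phases (expi c *: U) (fun j => a j + c).
Proof.
move=> Uu /(unitary_phase_mx Uu)[S Su ->]; rewrite -phase_mxZ.
exact: phase_mx_phases.
Qed.

(** Half of the rotation is applied twice. For Jordan angles the differences [b j - c] can reach a
    full turn, which [phase_shift] excludes. *)
Lemma phase_shift4 n (U S : 'M[C]_n) a g :
  U \is unitarymx -> has_phases U a -> S \is unitarymx ->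
  (forall j, 0 <= g j < pi *+ 4) ->
  exists t : 'I_n -> R, [/\ forall j, a j <= t j, \sum_j t j = \sum_j a j + \sum_j g j &
    has_phases (U *m phase_mx S g) t].
Proof.
move=> Uu Ua Su g0.
have h0 j : 0 <= g j / 2 < pi *+ 2.
  have /andP[h1 h2] := g0 j; apply/andP; split; first by rewrite divr_ge0.
  by rewrite ltr_pdivrMr // mulr_natr -mulrnA.
have [t [ta ts te]] := phase_shift Uu Ua Su h0.
have Vu := mul_unitarymx Uu (phase_mx_unitary (fun j => g j / 2) Su).
have [u [ut us ue]] := phase_shift Vu te Su h0.
exists u; split.
- by move=> j; apply: le_trans (ta j) (ut j).
- rewrite us ts -addrA -big_split /=; congr (_ + _); apply: eq_bigr => j _.
  by field.
have eg : (fun j => g j / 2 + g j / 2) = g by apply/funext => j; field.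
by move: ue; rewrite -mulmxA (phase_mxD _ _ Su) eg.
Qed.

Lemma has_phases_eq n (U : 'M[C]_n) a b : has_phases U a -> has_phases U b ->
  exists (s : 'S_n) (m : 'I_n -> int), forall j, a j = b (s j) + pi *+ 2 *~ m j.
Proof.
rewrite /has_phases => -> /prod_XsubC_perm[s hs]; exists s.
have h j : exists m : int, a j = b (s j) + pi *+ 2 *~ m by apply: expi_eq; exact: hs.
by have [m hm] := choice h; exists m.
Qed.

(* Li--Mathias argument: shifting [V] by [expi (- c)] and discarding the negative part of its
   phases only increases the phases, and the total increase is read off the determinant. *)
Theorem unitary_lidskii n (U V : 'M[C]_n) a b t c :
  U \is unitarymx -> V \is unitarymx ->
  has_phases U a -> has_phases V b -> has_phases (U *m V) t ->
  \sum_j t j = \sum_j a j + \sum_j b j ->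
  (forall i j, 0 <= (t i - t j) * (a i - a j)) ->
  (forall i j, a i - a j <= pi *+ 2) -> (forall i j, t i - t j <= pi *+ 2) ->
  (forall j, `|b j - c| < pi *+ 4) ->
  \sum_j Num.max (t j - a j - c) 0 <= \sum_j Num.max (b j - c) 0.
Proof.
move=> Uu Vu Ua Vb UVt st com aw tw bc.
have [S Su VE] := unitary_phase_mx Vu Vb.
have p4 : 0 < (pi : R) *+ 4 by rewrite mulrn_wgt0 ?pi_gt0.
have gp j : 0 <= Num.max (b j - c) 0 < pi *+ 4.
  have := bc j; rewrite ltr_norml => /andP[h1 h2].
  by case: (leP (b j - c) 0) => h3; apply/andP; split; lra.
have gm j : 0 <= Num.max (c - b j) 0 < pi *+ 4.
  have := bc j; rewrite ltr_norml => /andP[h1 h2].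
  by case: (leP (c - b j) 0) => h3; apply/andP; split; lra.
(* Two routes lead to one matrix: from [U] by the positive part of [b - c], with phases [x], and
   from the shifted product by its negative part, with phases [y]. *)
have [x [xa sx xe]] := phase_shift4 Uu Ua Su gp.
have UVu := mul_unitarymx Uu Vu.
have We := has_phases_shift (- c) UVu UVt.
have WE : expi (- c) *: (U *m V) = U *m phase_mx S (fun j => b j - c).
  by rewrite (phase_mxZ S b (- c)) -VE scalemxAr.
rewrite WE in We.
have Wu := mul_unitarymx Uu (phase_mx_unitary (fun j => b j - c) Su).
have [y [yd sy ye]] := phase_shift4 Wu We Su gm.
have eg : (fun j => b j - c + Num.max (c - b j) 0) = (fun j => Num.max (b j - c) 0).
  by apply/funext => j; case: (leP (c - b j) 0) => ?; case: (leP (b j - c) 0) => ?; lra.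
rewrite -mulmxA (phase_mxD _ _ Su) eg in ye.
have [s [m hm]] := has_phases_eq xe ye.
have sb : \sum_j Num.max (b j - c) 0 = \sum_j (b j - c) + \sum_j Num.max (c - b j) 0.
  by rewrite -big_split /=; apply: eq_bigr => j _; rewrite -(congr1 (@^~ j) eg).
have sxy : \sum_j x j = \sum_j y j.
  by rewrite sx sy sb !big_split /= st; ring.
have m0 : \sum_j m j = 0.
  have : pi *+ 2 *~ (\sum_j m j) = 0 :> R.
    have := sxy; under eq_bigr do rewrite hm.
    rewrite big_split /= -(reindex_inj (@perm_inj _ s) (P := xpredT) (F := y)) /=.
    by move=> e; apply: (@addrI _ (\sum_j y j)); rewrite addr0 mulrz_sumr.
  move/eqP; rewrite mulrz_eq0 => /orP[/eqP//|].
  by rewrite gt_eqF // mulrn_wgt0 // pi_gt0.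
(* Each [x k] dominates [a k] and also the entry of [t - c] paired with it, turns included, hence
   their maximum. *)
have key := @sum_max_wrap R n a (fun j => t j - c) s m (pi *+ 2).
have : \sum_k Num.max (a k) (t k - c) <= \sum_k x k.
  apply: le_trans (key _ _ aw _ m0) _.
  - by move=> i j; rewrite opprB addrA subrK; apply: com.
  - by rewrite mulrn_wge0 // pi_ge0.
  - by move=> i j; rewrite opprB addrA subrK; apply: tw.
  - by apply: ler_sum => k _; rewrite ge_max xa hm lerD2r yd.
rewrite sx -lerBlDl; apply: le_trans; rewrite -sumrB; apply: ler_sum => k _.
by case: (leP (t k - a k - c) 0) => ?; case: (leP (a k) (t k - c)) => ?; lra.
Qed.

End Lidskii.

(** * Products of reflections *)

Section Reflections.
Local Open Scope sesquilinear_scope.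

(** Sylvester's identity, with powers of [y] cleared so that [y] need not be invertible. *)
Lemma det_addmx_mulC (K : comNzRingType) n m (y : K) (G : 'M[K]_(n, m)) (H : 'M[K]_(m, n)) :
  \det (y%:M + G *m H) * y ^+ m = y ^+ n * \det (y%:M + H *m G).
Proof.
pose B : 'M[K]_(n + m) := block_mx y%:M (- G) H 1%:M.
have B1 : B *m block_mx 1%:M 0 (- H) 1%:M = block_mx (y%:M + G *m H) (- G) 0 1%:M.
  rewrite mulmx_block !mulmx1 !mulmx0 !mul1mx mulNmx mulmxN opprK.
  by rewrite subrr !add0r.
have B2 : B *m block_mx 1%:M G 0 y%:M = block_mx y%:M 0 H (y%:M + H *m G).
  rewrite mulmx_block !mulmx1 !mulmx0 !mul1mx !addr0 mulNmx.
  by rewrite mul_scalar_mx mul_mx_scalar subrr [in RHS]addrC.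
have := congr1 determinant B1; have := congr1 determinant B2.
rewrite !det_mulmx !det_lblock !det_ublock !det1 !det_scalar !mul1r !mulr1.
by move=> e2 e1; rewrite -e1.
Qed.

Lemma mulmxnAl (K : pzRingType) m n p (A : 'M[K]_(m, n)) (B : 'M[K]_(n, p)) k :
  (A *+ k) *m B = (A *m B) *+ k.
Proof. by rewrite -!scaler_nat scalemxAl. Qed.

Lemma mulmxnAr (K : comPzRingType) m n p (A : 'M[K]_(m, n)) (B : 'M[K]_(n, p)) k :
  A *m (B *+ k) = (A *m B) *+ k.
Proof. by rewrite -!scaler_nat scalemxAr. Qed.

Lemma det_block_scalar (K : idomainType) p (a : K) (B C : 'M[K]_p) : a != 0 ->
  \det (block_mx a%:M B C (- a%:M)) = (-1) ^+ p * \det ((a ^+ 2)%:M + B *m C).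
Proof.
move=> a0; apply: (@mulIf _ (a ^+ p)); first exact: expf_neq0.
have := congr1 determinant (mulmx_block a%:M B C (- a%:M) a%:M 0 C 1%:M).
rewrite !mulmx1 !mulmx0 !add0r mulNmx !mul_scalar_mx mul_mx_scalar subrr.
rewrite det_mulmx det_lblock det_ublock det1 mulr1 det_scalar => ->.
rewrite scale_scalar_mx -expr2 -scaleN1r detZ det_scalar; ring.
Qed.

Variable F : fieldType.

Definition reflmx p n (L : 'M[F]_(p, n)) : 'M[F]_n := L^T *m L *+ 2 - 1%:M.

Lemma reflmxK p n (L : 'M[F]_(p, n)) : L *m L^T = 1%:M -> reflmx L *m reflmx L = 1%:M.
Proof.
move=> LL; have PP : L^T *m L *m (L^T *m L) = L^T *m L.
  by rewrite mulmxA -(mulmxA L^T) LL mulmx1.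
rewrite /reflmx mulmxBl mul1mx mulmxBr mulmx1 mulr2n mulmxDl mulmxDr PP.
by rewrite addrK opprB addrC subrK.
Qed.

(** Multiplying ['X - R_L R_M] by the involution [R_M] gives ['X R_M - R_L], the scalar [1 - 'X]
    plus a term of rank at most [2 p]. Sylvester's identity then leaves a determinant of size [2 p],
    with scalar diagonal blocks. *)
Lemma char_poly_reflmx p r (L M : 'M[F]_(p, p + (p + r))) :
  L *m L^T = 1%:M -> M *m M^T = 1%:M ->
  char_poly (reflmx L *m reflmx M) = ('X - 1) ^+ r *
    \det ((('X + 1) ^+ 2)%:M - ('X *+ 4) *: map_mx polyC ((L *m M^T)^T *m (L *m M^T))).
Proof.
move=> LL MM; set n := (p + (p + r))%N in L M LL MM *.
set l := map_mx polyC L; set m := map_mx polyC M.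
have ll : l *m l^T = 1%:M by rewrite map_trmx -map_mxM LL map_mx1.
have mm : m *m m^T = 1%:M by rewrite map_trmx -map_mxM MM map_mx1.
have mapr (N : 'M[F]_(p, n)) : map_mx polyC (reflmx N) =
    (map_mx polyC N)^T *m map_mx polyC N *+ 2 - 1%:M.
  by rewrite /reflmx map_mxB map_mx1 raddfMn /= map_mxM map_trmx.
set D := \det _.
have detM : \det (map_mx polyC (reflmx M)) * (-1) ^+ p = (-1) ^+ n :> {poly F}.
  have := det_addmx_mulC (-1) (m^T *+ 2) m.
  rewrite mapr -/m mulmxnAl.
  have -> : (-1 : {poly F})%:M + m *m (m^T *+ 2) = 1%:M.
    by rewrite mulmxnAr mm raddfN /= mulr2n addrA addNr add0r.
  by rewrite det1 mulr1 raddfN /= [- _ + _]addrC.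
have a0 : 'X + 1 != 0 :> {poly F} by rewrite -polyC1 monic_neq0 // monicXaddC.
have key : \det ('X *: map_mx polyC (reflmx M) - map_mx polyC (reflmx L)) =
    (1 - 'X) ^+ r * ((-1) ^+ p * D).
  have x1 : (1 - 'X : {poly F}) ^+ (p + p) != 0.
    by rewrite expf_neq0 // -opprB oppr_eq0 -polyC1 monic_neq0 // monicXsubC.
  apply: (mulIf x1).
  have := det_addmx_mulC (1 - 'X) (row_mx ('X *: (m^T *+ 2)) (- (l^T *+ 2))) (col_mx m l).
  rewrite mul_row_col mul_col_row.
  have -> : (1 - 'X)%:M + ('X *: (m^T *+ 2) *m m + - (l^T *+ 2) *m l) =
     'X *: map_mx polyC (reflmx M) - map_mx polyC (reflmx L).
    rewrite !mapr -/m -/l scalerBr scalemx1 raddfB /= -scalemxAl mulNmx !mulmxnAl opprB.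
    by rewrite addrACA [X in X + _ = _]addrC -!addrA; congr (_ + _); rewrite addrCA.
  move=> ->.
  have -> : (1 - 'X)%:M + block_mx (m *m ('X *: (m^T *+ 2))) (m *m - (l^T *+ 2))
        (l *m ('X *: (m^T *+ 2))) (l *m - (l^T *+ 2)) =
     block_mx ('X + 1)%:M (- (l *m m^T)^T *+ 2) ('X *: ((l *m m^T) *+ 2)) (- ('X + 1)%:M).
    rewrite trmx_mul trmxK -!scalemxAr !mulmxN !mulmxnAr mm ll.
    rewrite [_%:M as X in X + _](_ : _ = block_mx (1 - 'X)%:M 0 0 (1 - 'X)%:M); last first.
      by rewrite -scalar_mx_block.
    rewrite add_block_mx !add0r mulNrn; congr block_mx.
      by rewrite -scaler_nat scalerA scalemx1 -raddfD /=; congr (_%:M); ring.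
    by rewrite -raddfMn -raddfB /= -raddfN; congr (_%:M); ring.
  rewrite det_block_scalar //.
  have -> : (('X + 1) ^+ 2)%:M + (- (l *m m^T)^T *+ 2) *m ('X *: ((l *m m^T) *+ 2)) =
     (('X + 1) ^+ 2)%:M - ('X *+ 4) *: map_mx polyC ((L *m M^T)^T *m (L *m M^T)).
    rewrite mulNrn mulNmx !mulmxnAl -scalemxAr mulmxnAr scalerMnr -mulrnA -scalerMnl.
    by rewrite [in RHS]map_mxM -[in RHS]map_trmx !map_mxM -map_trmx -/l -/m -scalerMnr.
  by rewrite -/D /n !exprD; ring.
have : char_poly (reflmx L *m reflmx M) * \det (map_mx polyC (reflmx M)) =
    \det ('X *: map_mx polyC (reflmx M) - map_mx polyC (reflmx L)).
  rewrite /char_poly -det_mulmx /char_poly_mx map_mxM mulmxBl -mulmxA -map_mxM.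
  by rewrite reflmxK // map_mx1 mulmx1 mul_scalar_mx.
rewrite key => e.
apply: (@mulIf _ ((-1) ^+ n)); first by rewrite expf_neq0 // oppr_eq0 oner_neq0.
rewrite -{1}detM mulrA e /n !exprD.
have -> : ('X - 1 : {poly F}) ^+ r = (-1) ^+ r * (1 - 'X) ^+ r.
  by rewrite -exprMn mulN1r opprB.
have s1 k : (-1 : {poly F}) ^+ k * (-1) ^+ k = 1 by rewrite -expr2 sqrr_sign.
transitivity ((1 - 'X) ^+ r * D * ((-1) ^+ p * (-1) ^+ p)); first by ring.
transitivity ((1 - 'X) ^+ r * D * ((-1) ^+ p * (-1) ^+ p) * ((-1) ^+ r * (-1) ^+ r)); last by ring.
by rewrite !s1 !mulr1.
Qed.

End Reflections.

(** * Jordan angles as eigenphases of a product of reflections *)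

Section JordanPhases.
Local Open Scope sesquilinear_scope.
Local Open Scope complex_scope.
Variable R : realType.
Local Notation C := R[i].
Local Notation toC := (map_mx (real_complex R)).

Lemma row_sqr_ge0 n (u : 'rV[R]_n) : 0 <= (u *m u^T) 0 0.
Proof. by rewrite mxE sumr_ge0 // => j _; rewrite mxE -expr2 sqr_ge0. Qed.

Lemma row_sqr_gt0 n (u : 'rV[R]_n) : u != 0 -> 0 < (u *m u^T) 0 0.
Proof.
move=> u0; rewrite lt_neqAle row_sqr_ge0 andbT eq_sym; apply: contra u0.
rewrite mxE psumr_eq0 => [/allP h|j _]; last by rewrite mxE -expr2 sqr_ge0.
apply/eqP/rowP => j; have := h j (mem_index_enum _).
by rewrite /= !mxE -expr2 sqrf_eq0 => /eqP.
Qed.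

(** Pythagoras: the difference is the squared length of [u - u P], for the projection [P] onto the
    row space. *)
Lemma orthonormal_rows_contract p n (L : 'M[R]_(p, n)) (u : 'rV[R]_n) :
  orthonormal_rows L -> (u *m L^T *m (u *m L^T)^T) 0 0 <= (u *m u^T) 0 0.
Proof.
rewrite /orthonormal_rows => LL; rewrite -subr_ge0.
set P := L^T *m L.
have PP : P *m P = P by rewrite /P mulmxA -(mulmxA L^T) LL mulmx1.
have PT : P^T = P by rewrite /P trmx_mul trmxK.
have -> : u *m L^T *m (u *m L^T)^T = u *m P *m u^T.
  by rewrite trmx_mul trmxK /P !mulmxA.
clearbody P.
have -> : (u *m u^T) 0 0 - (u *m P *m u^T) 0 0 = ((u - u *m P) *m (u - u *m P)^T) 0 0.
  transitivity ((u *m u^T - u *m P *m u^T) 0 0); first by rewrite !mxE.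
  congr (fun_of_matrix _ 0 0).
  rewrite linearB /= [(u *m P)^T]trmx_mul PT mulmxBl !mulmxBr.
  by rewrite !mulmxA -(mulmxA u P P) PP subrr subr0.
exact: row_sqr_ge0.
Qed.

(** For an eigenvector [v], [v M] has the length of [v], and multiplication by [L^T] does not
    lengthen it. The bound is needed because [acos] inverts [cos] only on [[-1, 1]]. *)
Lemma singular_value_le1 p n (L M : 'M[R]_(p, n)) s j :
  orthonormal_rows L -> orthonormal_rows M -> singular_values (Lambda L M) s -> s 0 j <= 1.
Proof.
move=> LL MM [s0 [_ cp]].
have : eigenvalue ((Lambda L M)^T *m Lambda L M) (s 0 j ^+ 2).
  rewrite eigenvalue_root_char cp rootE horner_prod (bigD1 j) //= hornerXsubC subrr mul0r //.
move=> /eigenvalueP[v va v0].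
have e : (v *m M *m L^T *m (v *m M *m L^T)^T) 0 0 = s 0 j ^+ 2 * (v *m v^T) 0 0.
  have -> : v *m M *m L^T *m (v *m M *m L^T)^T = s 0 j ^+ 2 *: (v *m v^T).
    rewrite scalemxAl -va /Lambda !trmx_mul !trmxK !mulmxA //.
  by rewrite mxE.
have := orthonormal_rows_contract (v *m M) LL; rewrite e.
have -> : v *m M *m (v *m M)^T = v *m v^T.
  by rewrite trmx_mul mulmxA -(mulmxA v) MM mulmx1.
rewrite ger_pMl ?row_sqr_gt0 // expr_le1 // ?s0 //.
Qed.

Lemma toC_conj m n (A : 'M[R]_(m, n)) : (toC A)^t* = toC A^T.
Proof. by apply/matrixP => i j; rewrite !mxE; exact: conjc_real. Qed.

Lemma toC_orthonormal p n (L : 'M[R]_(p, n)) : orthonormal_rows L -> toC L *m (toC L)^T = 1%:M.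
Proof. by rewrite /orthonormal_rows => LL; rewrite map_trmx -map_mxM LL map_mx1. Qed.

Lemma reflmx_unitary p n (L : 'M[R]_(p, n)) : orthonormal_rows L ->
  reflmx (toC L) \is unitarymx.
Proof.
move=> LL; have rE : reflmx (toC L) = toC (reflmx L).
  by rewrite /reflmx map_mxB map_mx1 raddfMn /= map_mxM map_trmx.
apply/unitarymxP; rewrite {2}rE toC_conj.
have -> : (reflmx L)^T = reflmx L.
  by rewrite /reflmx linearB /= raddfMn /= trmx_mul trmxK trmx1.
by rewrite -rE reflmxK // toC_orthonormal.
Qed.

(** A homogenized characteristic polynomial: diagonalizing [A] allows a polynomial coefficient [z],
    as [char_poly_reflmx] requires. *)
Lemma det_scalar_sub_normal p (A : 'M[C]_p) (c : 'I_p -> C) (y z : {poly C}) :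
  A \is normalmx -> char_poly A = \prod_j ('X - (c j)%:P) ->
  \det (y%:M - z *: map_mx polyC A) = \prod_j (y - z * (c j)%:P).
Proof.
move=> An Ac; have [S Su ->] := normal_diag An Ac.
have SS : map_mx polyC (S^t*) *m map_mx polyC S = 1%:M.
  by rewrite -map_mxM unitarymx_tmulC // map_mx1.
set S1 := map_mx polyC (S^t*) in SS *; set S2 := map_mx polyC S in SS *.
have -> : y%:M - z *: map_mx polyC (S^t* *m diag_mx (\row_j c j) *m S) =
   S1 *m diag_mx (\row_j (y - z * (c j)%:P)) *m S2.
  have -> : diag_mx (\row_j (y - z * (c j)%:P)) = y%:M - z *: map_mx polyC (diag_mx (\row_j c j)).
    rewrite map_diag_mx -linearZ -diag_const_mx -raddfB /=; congr diag_mx.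
    by apply/rowP => j; rewrite !mxE.
  rewrite mulmxBr mulmxBl mul_mx_scalar -scalemxAl SS scalemx1; congr (_ - _).
  by rewrite -scalemxAr -scalemxAl !map_mxM.
rewrite !det_mulmx mulrAC -det_mulmx SS det1 mul1r det_diag.
by apply: eq_bigr => j _; rewrite mxE.
Qed.

(* Eigenphases of the product of the reflections in two [p]-planes with Jordan angles [phi]. *)
Definition double_angles p r (phi : 'rV[R]_p) : 'rV[R]_(p + (p + r)) :=
  row_mx (phi *+ 2) (row_mx (- (phi *+ 2)) 0).

Lemma big_double_angles (T : Type) (idx : T) (op : Monoid.com_law idx) p r (F : 'I_(p + (p + r)) -> T) :
  \big[op/idx]_k F k = op (\big[op/idx]_(j < p) F (lshift _ j))
   (op (\big[op/idx]_(j < p) F (rshift _ (lshift _ j))) (\big[op/idx]_(j < r) F (rshift _ (rshift _ j)))).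
Proof. by rewrite big_split_ord; congr (op _ _); rewrite big_split_ord. Qed.

Lemma double_anglesE p r (phi : 'rV[R]_p) :
  ((forall j, double_angles r phi 0 (lshift _ j) = phi 0 j *+ 2) *
  (forall j, double_angles r phi 0 (rshift _ (lshift _ j)) = - (phi 0 j *+ 2)) *
  (forall j, double_angles r phi 0 (rshift _ (rshift _ j)) = 0))%type.
Proof.
by split; [split|] => j; rewrite /double_angles ?row_mxEl ?row_mxEr ?row_mxEl ?row_mxEr ?mxE ?mulmxnE.
Qed.

(** One mirrored pair of phases accounts for one factor of the determinant in [char_poly_reflmx], by
    the duplication formula for the cosine. *)
Lemma chord_poly (t : R) :
  ('X - (expi (t *+ 2))%:P) * ('X - (expi (- (t *+ 2)))%:P) =
  ('X + 1) ^+ 2 - ('X *+ 4) * ((cos t ^+ 2)%:C)%:P :> {poly C}.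
Proof.
have e1 : expi (t *+ 2) + expi (- (t *+ 2)) = 4 * (cos t ^+ 2)%:C - 2.
  rewrite /expi cosN sinN cos_mulr2n.
  by apply/eqP; rewrite eq_complex /=; apply/andP; split; apply/eqP; ring.
have e2 : expi (t *+ 2) * expi (- (t *+ 2)) = 1 by rewrite mulrC expiN.
transitivity ('X ^+ 2 - (expi (t *+ 2) + expi (- (t *+ 2)))%:P * 'X
   + (expi (t *+ 2) * expi (- (t *+ 2)))%:P : {poly C}).
  by rewrite polyCD polyCM; ring.
rewrite e1 e2 polyCB polyCM !polyC_natr polyC1; ring.
Qed.

Lemma reflmx_phases p r (L M : 'M[R]_(p, p + (p + r))) s :
  orthonormal_rows L -> orthonormal_rows M -> singular_values (Lambda L M) s ->
  has_phases (reflmx (toC L) *m reflmx (toC M)) (double_angles r (jordan_angles s) 0).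
Proof.
move=> LL MM sv; have s1 j := singular_value_le1 j LL MM sv.
have [s0 [_ cp]] := sv.
rewrite /has_phases char_poly_reflmx ?toC_orthonormal //.
have -> : toC L *m (toC M)^T = toC (Lambda L M) by rewrite map_trmx -map_mxM.
set A := (toC (Lambda L M))^T *m toC (Lambda L M).
have AE : A = toC ((Lambda L M)^T *m Lambda L M) by rewrite /A map_trmx -map_mxM.
have An : A \is normalmx.
  have AT : A^t* = A by rewrite AE toC_conj trmx_mul trmxK.
  by apply/normalmxP; rewrite AT.
have Ac : char_poly A = \prod_j ('X - ((s 0 j ^+ 2)%:C)%:P).
  rewrite AE -map_char_poly cp rmorph_prod /=; apply: eq_bigr => j _.
  by rewrite rmorphB /= map_polyX map_polyC.
rewrite (det_scalar_sub_normal _ _ An Ac) big_double_angles /= mulrA mulrC; congr (_ * _).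
  rewrite -big_split /=; apply: eq_bigr => j _; rewrite !double_anglesE.
  rewrite chord_poly /jordan_angles mxE acosK // in_itv /= s1 andbT.
  by rewrite (le_trans _ (s0 j)) // lerN10.
rewrite (eq_bigr (fun=> 'X - 1)) => [|j _]; last by rewrite double_anglesE expi0.
by rewrite prodr_const card_ord.
Qed.

End JordanPhases.

(** * Majorization of Jordan angles *)

Section AngleMajorization.
Local Open Scope sesquilinear_scope.
Variable R : realType.
Local Notation toC := (map_mx (real_complex R)).

Lemma jordan_angles_itv p n (L M : 'M[R]_(p, n)) s j :
  orthonormal_rows L -> orthonormal_rows M -> singular_values (Lambda L M) s ->
  0 <= jordan_angles s 0 j <= pi / 2.
Proof.
move=> LL MM sv; have s1 := singular_value_le1 j LL MM sv; have [/(_ j) s0 _] := sv.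
have s11 : -1 <= s 0 j <= 1 by rewrite s1 (le_trans _ s0) // lerN10.
rewrite mxE acos_ge0 //= leNgt; apply/negP => h.
have := @ltr_cos R (pi / 2) (acos (s 0 j)).
rewrite !in_itv /= acos_ge0 // acos_lepi // divr_ge0 ?pi_ge0 //=.
rewrite ler_pdivrMr // ler_peMr ?pi_ge0 ?ler1n // => /(_ isT isT).
by rewrite h acosK ?in_itv //= cos_pihalf ltNge s0.
Qed.

Lemma jordan_angles_le p n (L M : 'M[R]_(p, n)) s (i j : 'I_p) :
  orthonormal_rows L -> orthonormal_rows M -> singular_values (Lambda L M) s ->
  (i <= j)%N -> jordan_angles s 0 i <= jordan_angles s 0 j.
Proof.
move=> LL MM sv ij.
have i01 k : 0 <= s 0 k /\ s 0 k <= 1.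
  by split; [case: sv | exact: singular_value_le1 LL MM sv].
have s11 k : -1 <= s 0 k <= 1.
  by have [h ->] := i01 k; rewrite (le_trans _ h) // lerN10.
rewrite !mxE leNgt -(@ltr_cos R) ?in_itv /= ?acos_ge0 ?acos_lepi //.
by rewrite !acosK ?in_itv //= -leNgt; case: sv => _ [h _]; exact: h.
Qed.

Lemma double_angles_ind p r (P : R -> R -> Prop) (u v : 'rV[R]_p) :
  (forall j, P (u 0 j *+ 2) (v 0 j *+ 2)) ->
  (forall j, P (- (u 0 j *+ 2)) (- (v 0 j *+ 2))) -> P 0 0 ->
  forall k, P (double_angles r u 0 k) (double_angles r v 0 k).
Proof.
move=> h1 h2 h3 k; case: (fintype.splitP k) => [j e|k' e].
  by rewrite (_ : k = lshift _ j) ?double_anglesE //; apply/val_inj.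
case: (fintype.splitP k') => [j e'|j e'].
  by rewrite (_ : k = rshift _ (lshift _ j)) ?double_anglesE //; apply/val_inj; rewrite /= e e'.
by rewrite (_ : k = rshift _ (rshift _ j)) ?double_anglesE //; apply/val_inj; rewrite /= e e'.
Qed.

(** Entries of different blocks compare by sign alone, equally for [u] and [v]; inside the mirrored
    block both differences change sign. *)
Lemma double_angles_comonotone p r (u v : 'rV[R]_p) :
  (forall j, 0 <= u 0 j) -> (forall j, 0 <= v 0 j) ->
  (forall i j, 0 <= (u 0 i - u 0 j) * (v 0 i - v 0 j)) ->
  forall k l, 0 <= (double_angles r u 0 k - double_angles r u 0 l) *
                   (double_angles r v 0 k - double_angles r v 0 l).
Proof.
move=> u0 v0 uv k l.
pose P (x y : R) : Prop := 0 <= (x - double_angles r u 0 l) * (y - double_angles r v 0 l).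
apply: (@double_angles_ind p r P u v) => [j|j|]; rewrite /P.
- pose P' (x y : R) : Prop := 0 <= (u 0 j *+ 2 - x) * (v 0 j *+ 2 - y).
  apply: (@double_angles_ind p r P' u v) => [i|i|]; rewrite /P';
    have := u0 j; have := v0 j; rewrite ?subr0; try (have := uv j i; have := u0 i; have := v0 i); nra.
- pose P' (x y : R) : Prop := 0 <= (- (u 0 j *+ 2) - x) * (- (v 0 j *+ 2) - y).
  apply: (@double_angles_ind p r P' u v) => [i|i|]; rewrite /P';
    have := u0 j; have := v0 j; rewrite ?subr0; try (have := uv j i; have := u0 i; have := v0 i); nra.
- pose P' (x y : R) : Prop := 0 <= (0 - x) * (0 - y).
  apply: (@double_angles_ind p r P' u v) => [i|i|]; rewrite /P'; rewrite ?sub0r;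
    try (have := u0 i; have := v0 i); nra.
Qed.

Lemma double_angles_width p r (u : 'rV[R]_p) :
  (forall j, 0 <= u 0 j <= pi / 2) ->
  forall k, `|double_angles r u 0 k| <= pi.
Proof.
move=> uw; apply: (@double_angles_ind p r (fun x _ => `|x| <= pi) u u) => [j|j|].
- by have /andP[h1 h2] := uw j; rewrite ger0_norm ?mulrn_wge0 // mulr2n; lra.
- by have /andP[h1 h2] := uw j; rewrite normrN ger0_norm ?mulrn_wge0 // mulr2n; lra.
- by rewrite normr0 pi_ge0.
Qed.

(** For [c >= 0] at most one term on the right is nonzero, which one depending on the sign of
    [x - y]. *)
Lemma max_abs_double (x y c : R) : 0 <= c ->
  2 * Num.max (`|x - y| - c) 0 <=
  Num.max (x *+ 2 - y *+ 2 - c *+ 2) 0 + Num.max (- (x *+ 2) - - (y *+ 2) - c *+ 2) 0.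
Proof.
move=> c0; case: (leP (x *+ 2 - y *+ 2 - c *+ 2) 0) => ?;
  case: (leP (- (x *+ 2) - - (y *+ 2) - c *+ 2) 0) => ?;
  by case: (ler0P (x - y)) => ?; [case: (leP (- (x - y) - c) 0) | case: (leP (x - y - c) 0)] => ?; lra.
Qed.

Lemma max_double (x c : R) : 0 <= x -> 0 <= c ->
  Num.max (x *+ 2 - c *+ 2) 0 + Num.max (- (x *+ 2) - c *+ 2) 0 <= 2 * Num.max (x - c) 0.
Proof.
move=> x0 c0; case: (leP (x *+ 2 - c *+ 2) 0) => ?;
  case: (leP (- (x *+ 2) - c *+ 2) 0) => ?; by case: (leP (x - c) 0) => ?; lra.
Qed.

Theorem jordan_angles_lidskii p r (L M N : 'M[R]_(p, p + (p + r))) sLM sMN sLN c :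
  orthonormal_rows L -> orthonormal_rows M -> orthonormal_rows N ->
  singular_values (Lambda L M) sLM -> singular_values (Lambda M N) sMN ->
  singular_values (Lambda L N) sLN -> 0 <= c <= pi / 2 ->
  \sum_j Num.max (`|(jordan_angles sLN - jordan_angles sLM) 0 j| - c) 0 <=
  \sum_j Num.max (jordan_angles sMN 0 j - c) 0.
Proof.
move=> LL MM NN svLM svMN svLN /andP[c0 c2].
set t := jordan_angles sLN; set a := jordan_angles sLM; set b := jordan_angles sMN.
have ai j : 0 <= a 0 j <= pi / 2 := jordan_angles_itv j LL MM svLM.
have bi j : 0 <= b 0 j <= pi / 2 := jordan_angles_itv j MM NN svMN.
have ti j : 0 <= t 0 j <= pi / 2 := jordan_angles_itv j LL NN svLN.
have UVt := reflmx_phases LL NN svLN.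
have Ua := reflmx_phases LL MM svLM.
have Vb := reflmx_phases MM NN svMN.
have RR : (reflmx (toC L) *m reflmx (toC M)) *m (reflmx (toC M) *m reflmx (toC N)) =
    reflmx (toC L) *m reflmx (toC N).
  have BB := reflmxK (toC_orthonormal MM).
  move: (reflmx (toC L)) (reflmx (toC M)) (reflmx (toC N)) BB => A B D BB.
  by rewrite mulmxA -(mulmxA A) BB mulmx1.
rewrite -RR -/t in UVt; rewrite -/a in Ua; rewrite -/b in Vb.
have Uu := mul_unitarymx (reflmx_unitary LL) (reflmx_unitary MM).
have Vu := mul_unitarymx (reflmx_unitary MM) (reflmx_unitary NN).
have s0 (u : 'rV[R]_p) : \sum_k double_angles r u 0 k = 0.
  rewrite big_double_angles /= [X in _ + (_ + X)]big1; last by move=> j _; rewrite double_anglesE.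
  by rewrite addr0 -big_split big1 //= => j _; rewrite !double_anglesE subrr.
have pi0 := pi_ge0 R; have pi1 := pi_gt0 R.
have w (u : 'rV[R]_p) : (forall j, 0 <= u 0 j <= pi / 2) ->
    forall k l, double_angles r u 0 k - double_angles r u 0 l <= pi *+ 2.
  move=> ui k l; have := double_angles_width ui k; have := double_angles_width ui l.
  by rewrite !ler_norml mulr2n => /andP[h1 h2] /andP[h3 h4]; lra.
have st : \sum_k double_angles r t 0 k = \sum_k double_angles r a 0 k + \sum_k double_angles r b 0 k.
  by rewrite !s0 addr0.
have com : forall k l, 0 <= (double_angles r t 0 k - double_angles r t 0 l) *
                   (double_angles r a 0 k - double_angles r a 0 l).
  apply: double_angles_comonotone => [j|j|i j]; [by case/andP: (ti j) | by case/andP: (ai j) |].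
  have [/ltnW ij|ij] := ltnP i j.
    have := jordan_angles_le LL NN svLN ij; have := jordan_angles_le LL MM svLM ij.
    by rewrite -/t -/a => h1 h2; nra.
  have := jordan_angles_le LL NN svLN ij; have := jordan_angles_le LL MM svLM ij.
  by rewrite -/t -/a => h1 h2; nra.
have bc k : `|double_angles r b 0 k - c *+ 2| < pi *+ 4.
  have := double_angles_width bi k; rewrite ler_norml ltr_norml => /andP[h1 h2].
  have -> : pi *+ 4 = 4 * pi :> R by rewrite mulr_natl.
  by rewrite mulr2n; apply/andP; split; lra.
have := unitary_lidskii Uu Vu Ua Vb UVt st com (w _ ai) (w _ ti) bc.
rewrite !big_double_angles /=.
set Z1 := \sum_(j < r) _; set Z2 := \sum_(j < r) _.
(* The [r] zero phases contribute equally to both sides and cancel. *)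
have Z12 : Z1 = Z2 by apply: eq_bigr => j _; rewrite !double_anglesE subr0.
rewrite Z12 !addrA lerD2r -!big_split /= => h.
rewrite -(@ler_pM2l _ 2) // !mulr_sumr.
apply: le_trans (le_trans h _); apply: ler_sum => j _; rewrite !double_anglesE.
  have -> : (t - a) 0 j = t 0 j - a 0 j by rewrite [LHS]mxE [X in _ + X]mxE.
  exact: max_abs_double.
by have /andP[h1 _] := bi j; exact: max_double.
Qed.

End AngleMajorization.

(** * Convex hulls of orbits of the hyperoctahedral group *)

Section Hull.
Variable R : realType.

Definition dotr p (u v : 'rV[R]_p) : R := \sum_j u 0 j * v 0 j.

(** The level is the least value of [z] on [J]: there the positive parts for [z] are exactly the
    differences over [J], while those for [x] can only exceed them. So only levels among the entries
    of [z] are ever tested. *)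
Lemma sum_level_le p (x z : 'I_p -> R) (J : {set 'I_p}) :
  (forall i j, i \notin J -> j \in J -> z i <= z j) ->
  (forall j, \sum_i Num.max (x i - z j) 0 <= \sum_i Num.max (z i - z j) 0) ->
  \sum_(i in J) x i <= \sum_(i in J) z i.
Proof.
move=> zJ maj; have [->|[j0 j0J]] := set_0Vmem J; first by rewrite !big_set0.
have [j jJ jmin] : exists2 j, j \in J & forall i, i \in J -> z j <= z i.
  by case: (@arg_minP _ _ _ j0 (mem J) z j0J) => j; exists j.
have e : \sum_i Num.max (z i - z j) 0 = \sum_(i in J) (z i - z j).
  rewrite (bigID (mem J)) /= [X in _ + X]big1 ?addr0 => [|i iJ].
    by apply: eq_bigr => i iJ; rewrite max_l // subr_ge0 jmin.
  by rewrite max_r // subr_le0 zJ.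
rewrite -(lerD2r (- \sum_(i in J) z j)) -!sumrB -e; apply: le_trans (maj j).
rewrite [X in _ <= X](bigID (mem J)) /= ler_wpDr ?sumr_ge0 // => [i _|].
  by rewrite le_max lexx orbT.
by apply: ler_sum => i _; rewrite le_max lexx.
Qed.

(* Layer-cake decomposition of [u]: each superlevel set of [u] is a top segment for [z]. *)
Lemma comonotone_majorize p (x z u : 'I_p -> R) :
  (forall j, \sum_i Num.max (x i - z j) 0 <= \sum_i Num.max (z i - z j) 0) ->
  (forall i, 0 <= u i) -> (forall i j, 0 <= (u i - u j) * (z i - z j)) ->
  \sum_i u i * x i <= \sum_i u i * z i.
Proof.
move=> maj; have [N] := ubnP #|[set i | 0 < u i]|.
elim: N u => // N IH u; rewrite ltnS => uN u0 com.
pose J := [set i | 0 < u i].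
have uJ i : i \notin J -> u i = 0.
  by rewrite inE -leNgt => h; apply/eqP; rewrite eq_le h u0.
have [J0|[j0 j0J]] := set_0Vmem J.
  have u00 i : u i = 0 by rewrite uJ // J0 inE.
  by rewrite !big1 // => i _; rewrite u00 mul0r.
have [j jJ jmin] : exists2 j, j \in J & forall i, i \in J -> u j <= u i.
  by case: (@arg_minP _ _ _ j0 (mem J) u j0J) => j; exists j.
have uj : 0 < u j by move: jJ; rewrite inE.
pose u' i := if i \in J then u i - u j else 0.
have split (y : 'I_p -> R) : \sum_i u i * y i = u j * \sum_(i in J) y i + \sum_i u' i * y i.
  rewrite mulr_sumr [X in X + _]big_mkcond -big_split /=; apply: eq_bigr => i _.
  by rewrite /u'; case: ifPn => iJ; [ring | rewrite uJ // mul0r addr0].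
rewrite !split lerD //.
  rewrite ler_pM2l //; apply: sum_level_le => // i k iJ kJ.
  have := com k i; rewrite (uJ _ iJ) subr0.
  by rewrite pmulr_rge0 ?subr_ge0 //; move: kJ; rewrite inE.
apply: IH.
- apply: leq_trans uN; apply: proper_card; apply/properP; split.
    apply/fintype.subsetP => i; rewrite !inE /u' inE; case: ifP => //.
    by rewrite ltxx.
  by exists j; rewrite // inE /u' jJ subrr ltxx.
- by move=> i; rewrite /u'; case: ifP => // iJ; rewrite subr_ge0 jmin.
- move=> i k; rewrite /u'; have := com i k.
  case: ifPn => iJ; case: ifPn => kJ h; rewrite ?subrr ?mul0r //.
  + by rewrite (_ : u i - u j - (u k - u j) = u i - u k) //; ring.
  + move: h; rewrite (uJ _ kJ) !subr0 pmulr_rge0; last by move: iJ; rewrite inE.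
    by move=> h; rewrite mulr_ge0 // subr_ge0 jmin.
  + move: h; rewrite (uJ _ iJ) !sub0r mulNr oppr_ge0 pmulr_rle0; last by move: kJ; rewrite inE.
    by move=> h; rewrite mulNr oppr_ge0 mulr_ge0_le0 // subr_ge0 jmin.
Qed.

(** The rearrangement principle: at a permutation maximizing the pairing, no transposition can
    increase it. *)
Lemma comonotone_perm p (u y : 'I_p -> R) :
  exists s : 'S_p, forall i j, 0 <= (u i - u j) * (y (s i) - y (s j)).
Proof.
pose f (s : 'S_p) := \sum_i u i * y (s i).
case: (@arg_maxP _ _ _ (1%g : 'S_p) xpredT f isT) => s _ smax; exists s => i j.
have [->|ij] := eqVneq i j; first by rewrite subrr mul0r.
have ji : j != i by rewrite eq_sym.
have : f (tperm i j * s)%g <= f s := smax _ isT.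
rewrite /f.
rewrite (bigD1 i) //= [X in _ <= X -> _](bigD1 i) //=.
rewrite (bigD1 j) //= [X in _ <= _ + X -> _](bigD1 j) //= !addrA.
rewrite [X in _ + X](eq_bigr (fun k => u k * y (s k))) => [|k /andP[ki kj]]; last first.
  by rewrite permM tpermD // eq_sym.
rewrite lerD2r !permM tpermL tpermR => h.
by rewrite -subr_ge0 in h; apply: le_trans h _; rewrite le_eqVlt; apply/orP; left; apply/eqP; ring.
Qed.

(** Signs following those of [xi] and an order following its absolute values reduce the claim to
    nonnegative comonotone vectors. *)
Lemma W_orbit_support p (x y xi : 'rV[R]_p) : (forall j, 0 <= y 0 j) ->
  (forall k, \sum_j Num.max (`|x 0 j| - y 0 k) 0 <= \sum_j Num.max (y 0 j - y 0 k) 0) ->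
  exists (s : 'S_p) (eps : 'I_p -> bool), dotr xi x <= dotr xi (W_act s eps y).
Proof.
move=> y0 maj; have [s hs] := comonotone_perm (fun i => `|xi 0 i|) (fun i => y 0 i).
exists s, (fun j => xi 0 j < 0).
have -> : dotr xi (W_act s (fun j => xi 0 j < 0) y) = \sum_j `|xi 0 j| * y 0 (s j).
  apply: eq_bigr => j _; rewrite mxE mulrA; congr (_ * _).
  have [h|h] := ltP (xi 0 j) 0; first by rewrite expr1 mulrN1 ltr0_norm.
  by rewrite expr0 mulr1 ger0_norm.
apply: (@le_trans _ _ (\sum_j `|xi 0 j| * `|x 0 j|)).
  by apply: ler_sum => j _; rewrite -normrM ler_norm.
apply: comonotone_majorize => // j.
rewrite [X in _ <= X](_ : _ = \sum_i Num.max (y 0 i - y 0 (s j)) 0); first exact: maj.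
by rewrite [RHS](reindex_inj (@perm_inj _ s)).
Qed.

(** Separation from a finite hull, by minimizing the distance to [x]. The minimum is taken over
    coefficients, which form a compact simplex. *)
Lemma hull_of_support p N (V : 'I_N -> 'rV[R]_p) (x : 'rV[R]_p) :
  (forall xi, exists l, dotr xi x <= dotr xi (V l)) ->
  exists c : 'I_N -> R, [/\ forall k, 0 <= c k, \sum_k c k = 1 & x = \sum_k c k *: V k].
Proof.
move=> sup; pose A : set 'rV[R]_N :=
  ([set c : 'rV[R]_N | forall k, `[0, 1]%classic (c ord0 k)] `&`
   (fun c : 'rV[R]_N => \sum_k c 0 k) @^-1` [set 1])%classic.
have Ac : compact A.
  apply: compact_closedI.
    by apply: (@rV_compact R _ (fun=> `[0, 1]%classic)) => k; exact: segment_compact.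
  apply: closed_comp => [c _|]; last exact: closed_eq.
  by apply: continuous_sum => k _; exact: coord_continuous.
have AP (c : 'rV[R]_N) : (forall k, 0 <= c 0 k) -> \sum_k c 0 k = 1 -> A c.
  move=> c0 c1; split=> //= k; rewrite in_itv /= c0 /= -c1 (bigD1 k) //= ler_wpDr // sumr_ge0 //.
pose dlt l : 'rV[R]_N := \row_k (k == l)%:R.
have dltE l (F : 'I_N -> 'rV[R]_p) : \sum_k dlt l 0 k *: F k = F l.
  rewrite (bigD1 l) //= big1 => [|k /negPf kl]; first by rewrite mxE eqxx scale1r addr0.
  by rewrite mxE kl scale0r.
have dlt0 l k : 0 <= dlt l 0 k by rewrite mxE ler0n.
have dlt1 l : \sum_k dlt l 0 k = 1.
  rewrite (bigD1 l) //= big1 => [|k /negPf kl]; first by rewrite mxE eqxx addr0.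
  by rewrite mxE kl.
have [l0 _] := sup 0.
pose z (c : 'rV[R]_N) := \sum_k c 0 k *: V k.
pose f (c : 'rV[R]_N) : R := \sum_j (x - z c) 0 j ^+ 2.
have fc : continuous f.
  have zc j : continuous (fun c => (x - z c) 0 j).
    have -> : (fun c => (x - z c) 0 j) = (fun c => x 0 j - \sum_k c 0 k * V k 0 j).
      apply/funext => c; rewrite mxE mxE summxE; congr (_ - _).
      by apply: eq_bigr => k _; rewrite mxE.
    have tk k : continuous (fun c : 'rV[R]_N => c 0 k * V k 0 j).
      move=> c; apply: (@cvgM R _ (nbhs c) (nbhs_filter c) (fun c : 'rV[R]_N => c 0 k) (fun=> V k 0 j)).
        exact: coord_continuous.
      exact: cvg_cst.
    move=> c; apply: (@cvgB R R _ (nbhs c) _ (fun=> x 0 j)); first exact: cvg_cst.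
    exact: (@continuous_sum _ _ _ _ _ (fun k (c : 'rV[R]_N) => c 0 k * V k 0 j)).
  apply: continuous_sum => j _ c.
  by apply: (@cvgM R _ (nbhs c) (nbhs_filter c) (fun c => (x - z c) 0 j) (fun c => (x - z c) 0 j)); exact: zc.
have A0 : (A !=set0)%classic by exists (dlt l0); apply: AP.
have [c /set_mem cA cmin] := EVT_min_rV A0 Ac (continuous_subspaceT fc).
have [cb c1] := cA; have c0 k : 0 <= c 0 k by have := cb k; rewrite /= in_itv /= => /andP[].
exists (fun k => c 0 k); split=> //; rewrite -/(z c).
pose xi := x - z c.
have opt l : dotr xi (V l) <= dotr xi (z c).
  pose d := V l - z c; pose q := dotr d d.
  suff : dotr xi d <= 0.
    move=> h; rewrite -subr_le0; apply: le_trans h; rewrite /dotr -sumrB.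
    by rewrite le_eqVlt; apply/orP; left; apply/eqP/eq_bigr => j _; rewrite !mxE; ring.
  (* Moving from [c] towards the vertex [l] cannot decrease the squared distance; the bound is its
     exact change. *)
  have tl (t : R) : 0 <= t <= 1 -> 0 <= t * (t * q - 2 * dotr xi d).
    move=> /andP[t0 t1]; pose ct := (1 - t) *: c + t *: dlt l.
    have ctA : A ct.
      apply: AP => [k|].
        rewrite [ct _ _]mxE [X in X + _]mxE [X in _ + X]mxE.
        by rewrite addr_ge0 // mulr_ge0 // subr_ge0.
      rewrite (eq_bigr (fun k => (1 - t) * c 0 k + t * dlt l 0 k)) => [|k _].
        by rewrite big_split /= -!mulr_sumr c1 dlt1; ring.
      by rewrite [LHS]mxE [X in X + _]mxE [X in _ + X]mxE.
    have zt : z ct = z c + t *: d.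
      rewrite /z (eq_bigr (fun k => (1 - t) *: (c 0 k *: V k) + t *: (dlt l 0 k *: V k))) => [|k _].
        rewrite big_split /= -!scaler_sumr dltE -/(z c) /d.
        by rewrite scalerBl scale1r scalerBr addrA addrAC.
      by rewrite !scalerA -scalerDl [ct _ _]mxE [X in X + _]mxE [X in _ + X]mxE.
    have := cmin ct (mem_set ctA); rewrite -subr_ge0 => /le_trans; apply.
    rewrite /f zt -sumrB /q /dotr !mulr_sumr -sumrB mulr_sumr.
    by apply: ler_sum => j _; rewrite /xi !mxE le_eqVlt; apply/orP; left; apply/eqP; ring.
  have q0 : 0 <= q by rewrite /q /dotr sumr_ge0 // => j _; rewrite -expr2 sqr_ge0.
  rewrite leNgt; apply/negP => dp.
  (* This denominator keeps [t] at most 1 and remains positive even when [q] is 0. *)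
  pose t := dotr xi d / (q + dotr xi d).
  have den : 0 < q + dotr xi d by rewrite ltr_wpDl.
  have t0 : 0 < t by rewrite divr_gt0.
  have t1 : t <= 1 by rewrite ler_pdivrMr // mul1r lerDr.
  have := tl t; rewrite (ltW t0) t1 => /(_ isT); rewrite pmulr_rge0 // => h.
  have : t * q <= dotr xi d.
    by rewrite /t mulrAC ler_pdivrMr // ler_pM2l // lerDl ltW.
  by lra.
have [l hl] := sup xi.
have : dotr xi xi <= 0.
  have := le_trans hl (opt l); rewrite -subr_le0 => h; apply: le_trans h; rewrite /dotr -sumrB.
  by rewrite le_eqVlt; apply/orP; left; apply/eqP/eq_bigr => j _; rewrite /xi !mxE; ring.
move=> h; apply/eqP; rewrite -subr_eq0 -/xi; apply/eqP/rowP => j; rewrite [RHS]mxE.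
have : \sum_j xi 0 j ^+ 2 == 0.
  by rewrite eq_le sumr_ge0 ?andbT // => i _; rewrite sqr_ge0.
rewrite psumr_eq0 => [/allP/(_ j (mem_index_enum _))|i _]; last exact: sqr_ge0.
by rewrite /= sqrf_eq0 => /eqP.
Qed.

Lemma convex_hull_W_orbit p (x y : 'rV[R]_p) :
  (forall xi, exists (s : 'S_p) (eps : 'I_p -> bool), dotr xi x <= dotr xi (W_act s eps y)) ->
  convex_hull (W_orbit y) x.
Proof.
(* Sign patterns are taken as finite functions so that the orbit is indexed by a finite type. *)
move=> sup; pose T : finType := ('S_p * {ffun 'I_p -> bool})%type.
pose V (k : 'I_#|T|) := let w : T := enum_val k in W_act w.1 w.2 y.
have [xi|c [c0 c1 xE]] := @hull_of_support p _ V x.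
  have [s [eps h]] := sup xi; exists (enum_rank ((s, finfun eps) : T)).
  rewrite /V enum_rankK /=; congr (_ <= dotr _ (W_act _ _ _)): h.
  by apply/funext => j; rewrite ffunE.
exists #|T|, V, c; split; last by [].
by move=> k; exists (enum_val k).1, (enum_val k).2.
Qed.

End Hull.

Unset Implicit Arguments.

Theorem theoremB (R : realType) (p q : nat) (hp : (0 < p)%N) (hpq : (p <= q)%N)
  (L M N : 'M[R]_(p, p + q))
  (hL : orthonormal_rows L) (hM : orthonormal_rows M) (hN : orthonormal_rows N)
  (sLM sMN sLN : 'rV[R]_p)
  (hLM : singular_values (Lambda L M) sLM)
  (hMN : singular_values (Lambda M N) sMN)
  (hLN : singular_values (Lambda L N) sLN) :
  let phi := jordan_angles sLM in
  let psi := jordan_angles sMN in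
  let theta := jordan_angles sLN in
  exists theta0 : 'rV[R]_p,
    (exists z, convex_hull (W_orbit psi) z /\ theta0 = phi + z) /\
    exists sigma : 'S_p, forall j : 'I_p,
      cos (theta0 0 j) = cos (theta 0 (sigma j)).
Proof.
move=> phi psi theta; exists theta; split; last by exists 1%g => j; rewrite perm1.
exists (theta - phi); split; last by rewrite addrC subrK.
have psi_itv j := jordan_angles_itv j hM hN hMN.
apply: convex_hull_W_orbit => xi; apply: W_orbit_support => [j|k].
  by case/andP: (psi_itv j).
(* The level is an entry of [psi], hence within the range [[0, pi / 2]] allowed for [c]. *)
have := psi_itv k; rewrite -/psi; move: (psi 0 k) => c.
(* Writing [q = p + r] makes room for [p] phases of each sign and [r] zero phases. *)
move: (q - p)%N (subnKC hpq) => r eq_q; subst q.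
exact: jordan_angles_lidskii hL hM hN hLM hMN hLN.
Qed.
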